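(* Let $p$ be an odd prime number, and let $Y/X$ be a Galois cover of finite graphs with Galois group $\Delta = \mathrm{Gal}(Y/X)$ isomorphic to $\mathbb{F}_p^\times$. Let $A$ be the $p$-primary subgroup of $\mathrm{Pic}^0(Y)$, viewed as a $\mathbb{Z}_p[\Delta]$-module. Then, for every non-trivial character $\psi:\Delta\to\mathbb{Z}_p^\times$, one has $$\# e_\psi A = |h_{Y/X}(1,\psi)|_p^{-1},$$ where $|\cdot|_p$ denotes the usual $p$-adic absolute value on $\mathbb{Z}_p$.
   Context: Graphs are in Serre's formalism: a finite graph $Y$ consists of a finite vertex set $V_Y$, a finite set $\mathbf{E}_Y$ of directed edges, an incidence map $\varepsilon \mapsto (o(\varepsilon),t(\varepsilon)) \in V_Y\times V_Y$, and a fixed-point-free involution $\varepsilon \mapsto \bar\varepsilon$ of $\mathbf{E}_Y$ with $o(\bar\varepsilon)=t(\varepsilon)$ and $t(\bar\varepsilon)=o(\varepsilon)$ (loops and multiple edges are allowed). For $w \in V_Y$, put $\mathbf{E}_{Y,w} = \{\varepsilon : o(\varepsilon)=w\}$ and $\mathrm{val}_Y(w) = \#\mathbf{E}_{Y,w}$. A Galois cover $Y/X$ consists of connected finite graphs $X,Y$ and a graph morphism $f:Y\to X$, surjective on vertices, that restricts to a bijection $\mathbf{E}_{Y,w}\to\mathbf{E}_{X,f(w)}$ for every $w\in V_Y$, and such that the group $G=\mathrm{Gal}(Y/X)$ of deck transformations (automorphisms $\sigma$ of $Y$ with $f\circ\sigma=f$) acts transitively on the fibre $f^{-1}(v)$ for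 each $v\in V_X$; the action of $G$ on $V_Y$ is then free. $\mathrm{Div}(Y)$ is the free abelian group on $V_Y$; $\mathrm{Div}^0(Y)$ is the kernel of the augmentation $\mathrm{Div}(Y)\to\mathbb{Z}$, $w\mapsto 1$. Define operators on $\mathrm{Div}(Y)$ by $\mathcal{D}(w)=\mathrm{val}_Y(w)\cdot w$, $\mathcal{A}(w)=\sum_{\varepsilon\in\mathbf{E}_{Y,w}}t(\varepsilon)$, and $\mathcal{L}=\mathcal{D}-\mathcal{A}$. Put $\mathrm{Pic}^0(Y)=\mathrm{Div}^0(Y)/\mathcal{L}(\mathrm{Div}(Y))$, a finite abelian group on which $\mathrm{Gal}(Y/X)$ acts. When $G=\mathrm{Gal}(Y/X)$ is abelian, $\mathrm{Div}(Y)$ is a free $\mathbb{Z}[G]$-module of rank $\#V_X$, and $\mathcal{D},\mathcal{A}$ are $\mathbb{Z}[G]$-linear. Set $\eta_{Y/X}(u)=\det_{\mathbb{Z}[G]}(\mathcal{I}-\mathcal{A}u+(\mathcal{D}-\mathcal{I})u^2)\in\mathbb{Z}[G][u]$, where $\mathcal{I}$ is the identity; in particular $\eta_{Y/X}(1)=\det_{\mathbb{Z}[G]}(\mathcal{L})\in\mathbb{Z}[G]$. For a commutative ring $R$ and a character $\psi:G\to R^\times$, extend $\psi$ to the ring morphism $\psi:\mathbb{Z}[G]\to R$ and put $h_{Y/X}(1,\psi)=\psi(\eta_{Y/X}(1))\in R$. For $\psi:\Delta\to\mathbb{Z}_p^\times$, $e_\psi=\frac{1}{\#\Delta}\sum_{\sigma\in\Delta}\psi(\sigma)\sigma^{-1}\in\mathbb{Z}_p[\Delta]$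 is the corresponding idempotent (note $\#\Delta=p-1\in\mathbb{Z}_p^\times$). *)

(* Defs.v *)
From HB Require Import structures.
From mathcomp Require Import all_boot all_order all_algebra all_fingroup.
From mathcomp Require Import generic_quotient ring_quotient.
From mathcomp Require Import boolp classical_sets functions cardinality.

Set Implicit Arguments.
Unset Strict Implicit.
Unset Printing Implicit Defensive.

Import Order.TTheory GRing.Theory Num.Theory.
Local Open Scope ring_scope.

(* The inverse limit of the Z/p^n: a p-adic integer x is the sequence of its  *)
(* residues x n in {0, .., p^n - 1}; the bound on x n follows from the        *)
(* compatibility condition.                                                   *)
Record padic_int (p : nat) (p_pr : prime p) := PadicInt {
  padic_res :> nat -> nat;
  _ : forall n, padic_res n = (padic_res n.+1 %% p ^ n)%N }.

HB.instance Definition _ p p_pr := gen_eqMixin (@padic_int p p_pr).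
HB.instance Definition _ p p_pr := gen_choiceMixin (@padic_int p p_pr).

Section PadicRing.
Variables (p : nat) (p_pr : prime p).
Implicit Types x y z : padic_int p_pr.

Lemma padic_resP x n : x n = (x n.+1 %% p ^ n)%N.
Proof. by case: x. Qed.

Lemma padic_res_mod x n : (x n %% p ^ n)%N = x n.
Proof. by rewrite [in LHS]padic_resP modn_mod -padic_resP. Qed.

Lemma padic_int_inj x y : (forall n, x n = y n) -> x = y.
Proof.
case: x y => [x xP] [y yP] /= /funext xy; subst y.
by congr PadicInt; exact: Prop_irrelevance.
Qed.

Fact padic_of_nat_subproof (u : nat -> nat) :
  (forall n, u n.+1 = u n %[mod p ^ n])%N ->
  forall n, (u n %% p ^ n = (u n.+1 %% p ^ n.+1) %% p ^ n)%N.
Proof. by move=> uP n; rewrite modn_dvdm ?uP // dvdn_exp2l. Qed.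

Definition padic_of_nat u uP : padic_int p_pr :=
  PadicInt p_pr (@padic_of_nat_subproof u uP).

Fact padic_res_succ x n : (x n.+1 = x n %[mod p ^ n])%N.
Proof. by rewrite -padic_resP padic_res_mod. Qed.

Fact padic_zero_subproof : (forall n, 0 = 0 %[mod p ^ n])%N.
Proof. by []. Qed.
Fact padic_one_subproof : (forall n, 1 = 1 %[mod p ^ n])%N.
Proof. by []. Qed.
Fact padic_add_subproof x y n : (x n.+1 + y n.+1 = x n + y n %[mod p ^ n])%N.
Proof. by rewrite -modnDm !padic_res_succ modnDm. Qed.
Fact padic_mul_subproof x y n : (x n.+1 * y n.+1 = x n * y n %[mod p ^ n])%N.
Proof. by rewrite -modnMm !padic_res_succ modnMm. Qed.
Fact padic_opp_subproof x n :
  (p ^ n.+1 - x n.+1 = p ^ n - x n %[mod p ^ n])%N.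
Proof.
have lex m : (x m <= p ^ m)%N.
  by rewrite -padic_res_mod ltnW // ltn_mod expn_gt0 prime_gt0.
apply/eqP; rewrite -(eqn_modDr (x n)) subnK // modnn.
rewrite -modnDmr -padic_res_succ modnDmr subnK //.
by rewrite -/(dvdn _ _) dvdn_exp2l.
Qed.

Definition padic_zero := padic_of_nat padic_zero_subproof.
Definition padic_one := padic_of_nat padic_one_subproof.
Definition padic_add x y := padic_of_nat (padic_add_subproof x y).
Definition padic_mul x y := padic_of_nat (padic_mul_subproof x y).
Definition padic_opp x := padic_of_nat (padic_opp_subproof x).

Fact padic_addA : associative padic_add.
Proof. by move=> x y z; apply: padic_int_inj => n /=; rewrite modnDml modnDmr addnA. Qed.
Fact padic_addC : commutative padic_add.
Proof. by move=> x y; apply: padic_int_inj => n /=; rewrite addnC. Qed.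
Fact padic_add0 : left_id padic_zero padic_add.
Proof. by move=> x; apply: padic_int_inj => n /=; rewrite mod0n add0n padic_res_mod. Qed.
Fact padic_addN : left_inverse padic_zero padic_opp padic_add.
Proof.
move=> x; apply: padic_int_inj => n /=; rewrite modnDml subnK ?modnn ?mod0n //.
by rewrite -padic_res_mod ltnW // ltn_mod expn_gt0 prime_gt0.
Qed.

HB.instance Definition _ := GRing.isZmodule.Build (padic_int p_pr)
  padic_addA padic_addC padic_add0 padic_addN.

Fact padic_mulA : associative padic_mul.
Proof. by move=> x y z; apply: padic_int_inj => n /=; rewrite modnMml modnMmr mulnA. Qed.
Fact padic_mulC : commutative padic_mul.
Proof. by move=> x y; apply: padic_int_inj => n /=; rewrite mulnC. Qed.
Fact padic_mul1 : left_id padic_one padic_mul.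
Proof. by move=> x; apply: padic_int_inj => n /=; rewrite modnMml mul1n padic_res_mod. Qed.
Fact padic_mulDl : left_distributive padic_mul padic_add.
Proof. by move=> x y z; apply: padic_int_inj => n /=; rewrite modnMml modnDm mulnDl. Qed.
Fact padic_one_neq0 : padic_one != padic_zero.
Proof.
apply/eqP => /(congr1 (fun x : padic_int p_pr => x 1%N)) /=.
by rewrite expn1 mod0n modn_small ?prime_gt1.
Qed.

HB.instance Definition _ := GRing.Zmodule_isComNzRing.Build (padic_int p_pr)
  padic_mulA padic_mulC padic_mul1 padic_mulDl padic_one_neq0.

Definition padic_unit : {pred padic_int p_pr} :=
  fun x => `[< exists y, y * x = 1 >].
Definition padic_inv x :=
  if pselect (exists y, y * x = 1) is left h then projT1 (cid h) else x.

Fact padic_mulV : {in padic_unit, left_inverse 1 padic_inv *%R}.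
Proof.
by move=> x /asboolP xu; rewrite /padic_inv; case: pselect => // h; case: cid.
Qed.
Fact padic_unitP x y : y * x = 1 -> padic_unit x.
Proof. by move=> yx; apply/asboolP; exists y. Qed.
Fact padic_inv_out : {in [predC padic_unit], padic_inv =1 id}.
Proof.
by move=> x /asboolP xnu; rewrite /padic_inv; case: pselect.
Qed.

HB.instance Definition _ := GRing.ComNzRing_hasMulInverse.Build (padic_int p_pr)
  padic_mulV padic_unitP padic_inv_out.

(* |x|_p = p^(-v), where v is the least n with x not divisible by p^(n+1);    *)
(* |0|_p = 0.                                                                 *)
Definition padic_abs x : rat :=
  if pselect (exists n, x n.+1 != 0%N) is left nzx
  then p%:R ^- ex_minn nzx else 0.

End PadicRing.

(* a : group_alg R gT stands for the sum of the (a g) g; an alias of          *)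
(* {ffun gT -> R}, which carries the pointwise product.                       *)
Definition group_alg (R : nzRingType) (gT : finGroupType) := {ffun gT -> R}.

Section GroupAlgebra.
Variables (R : nzRingType) (gT : finGroupType).
Notation RG := (group_alg R gT).
Implicit Types a b c : RG.

HB.instance Definition _ := GRing.Zmodule.on RG.

Definition group_alg_one : RG := [ffun g => (g == 1%g)%:R].
Definition group_alg_mul a b : RG := [ffun g => \sum_h a h * b (h^-1 * g)%g].

Fact group_alg_mulA : associative group_alg_mul.
Proof.
move=> a b c; apply/ffunP => g; rewrite !ffunE.
under eq_bigr do rewrite ffunE mulr_sumr.
under [RHS]eq_bigr do rewrite ffunE mulr_suml.
rewrite [RHS]exchange_big; apply: eq_bigr => h _ /=.
rewrite [RHS](reindex_inj (mulgI h)); apply: eq_bigr => k _ /=.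
by rewrite mulKg invMg mulgA mulrA.
Qed.
Fact group_alg_mul1l : left_id group_alg_one group_alg_mul.
Proof.
move=> a; apply/ffunP => g; rewrite ffunE (bigD1 1%g) //= big1 => [|h hN1].
  by rewrite ffunE eqxx invg1 !mul1r mul1g addr0.
by rewrite ffunE (negPf hN1) mul0r.
Qed.
Fact group_alg_mul1r : right_id group_alg_one group_alg_mul.
Proof.
move=> a; apply/ffunP => g; rewrite ffunE (bigD1 g) //= big1 => [|h hNg].
  by rewrite ffunE mulVg eqxx mulr1 addr0.
by rewrite ffunE -eq_mulVg1 (negPf hNg) mulr0.
Qed.
Fact group_alg_mulDl : left_distributive group_alg_mul +%R.
Proof.
move=> a b c; apply/ffunP => g; rewrite !ffunE -big_split.
by apply: eq_bigr => h _; rewrite ffunE mulrDl.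
Qed.
Fact group_alg_mulDr : right_distributive group_alg_mul +%R.
Proof.
move=> a b c; apply/ffunP => g; rewrite !ffunE -big_split.
by apply: eq_bigr => h _; rewrite ffunE mulrDr.
Qed.
Fact group_alg_one_neq0 : group_alg_one != 0.
Proof.
by apply/eqP => /ffunP/(_ 1%g)/eqP; rewrite !ffunE eqxx oner_eq0.
Qed.

HB.instance Definition _ := GRing.Zmodule_isNzRing.Build RG
  group_alg_mulA group_alg_mul1l group_alg_mul1r
  group_alg_mulDl group_alg_mulDr group_alg_one_neq0.

End GroupAlgebra.

Record is_character (R : comUnitRingType) (gT : finGroupType) (psi : gT -> R) :
  Prop := IsCharacter {
    character_unit : forall g, psi g \is a GRing.unit;
    character1 : psi 1%g = 1;
    characterM : forall g h, psi (g * h)%g = psi g * psi h }.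

Definition character_ext (R : comUnitRingType) (gT : finGroupType)
    (psi : gT -> R) (a : group_alg int gT) : R :=
  \sum_g psi g *~ a g.

(* e_psi = 1/#gT \sum_g psi(g) g^-1, written by its coefficients.             *)
Definition character_idem (R : comUnitRingType) (gT : finGroupType)
    (psi : gT -> R) : group_alg R gT :=
  [ffun g => (#|gT|%:R)^-1 * psi (g^-1)%g].

Record graph := Graph {
  vert : finType;
  edge : finType;
  orig : edge -> vert;
  targ : edge -> vert;
  ebar : edge -> edge;
  ebarK : involutive ebar;
  ebar_neq : forall e, ebar e != e;
  orig_bar : forall e, orig (ebar e) = targ e;
  targ_bar : forall e, targ (ebar e) = orig e }.

Definition out_edges (Y : graph) (w : vert Y) : {set edge Y} :=
  [set e | orig e == w].

Definition valency (Y : graph) (w : vert Y) : nat := #|out_edges w|.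

Definition adjacent (Y : graph) : rel (vert Y) :=
  fun v w => [exists e : edge Y, (orig e == v) && (targ e == w)].

Definition connected_graph (Y : graph) : Prop :=
  forall v w : vert Y, connect (@adjacent Y) v w.

Record graph_morphism (Y X : graph) := GraphMorphism {
  fvert : vert Y -> vert X;
  fedge : edge Y -> edge X;
  fedge_orig : forall e, orig (fedge e) = fvert (orig e);
  fedge_targ : forall e, targ (fedge e) = fvert (targ e);
  fedge_bar : forall e, fedge (ebar e) = ebar (fedge e) }.

Section Deck.
Variables (Y X : graph) (f : graph_morphism Y X).

(* The pair (sv, se) is an automorphism s of Y such that f \o s = f.           *)
Definition is_deck (sv : {perm vert Y}) (se : {perm edge Y}) : bool :=
  [&& [forall e, orig (se e) == sv (orig e)],
      [forall e, targ (se e) == sv (targ e)],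
      [forall e, se (ebar e) == ebar (se e)],
      [forall w, fvert f (sv w) == fvert f w] &
      [forall e, fedge f (se e) == fedge f e]].

Definition deck_set : {set {perm vert Y} * {perm edge Y}} :=
  [set s | is_deck s.1 s.2].

Fact deck_group_set : group_set deck_set.
Proof.
apply/group_setP; split.
  by rewrite inE; apply/and5P; split; apply/forallP => e; rewrite !perm1.
move=> s t; rewrite !inE.
case/and5P => /forallP s1 /forallP s2 /forallP s3 /forallP s4 /forallP s5.
case/and5P => /forallP t1 /forallP t2 /forallP t3 /forallP t4 /forallP t5.
apply/and5P; split; apply/forallP => e; rewrite !permM.
- by rewrite (eqP (t1 _)) (eqP (s1 _)).
- by rewrite (eqP (t2 _)) (eqP (s2 _)).
- by rewrite (eqP (s3 _)) (eqP (t3 _)).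
- by rewrite (eqP (t4 _)) (eqP (s4 _)).
- by rewrite (eqP (t5 _)) (eqP (s5 _)).
Qed.
Canonical deck_group := Group deck_group_set.

(* Permutations are multiplied from left to right, so this is the opposite of *)
(* the usual group, and gal_div below is a left action only when the group is *)
(* abelian, in which case both groups agree.                                  *)
Definition Gal : finGroupType := subg_of deck_group.

Definition gal_vert (s : Gal) : {perm vert Y} := (sgval s).1.

Record galois_cover : Prop := GaloisCover {
  cover_source_connected : connected_graph Y;
  cover_target_connected : connected_graph X;
  cover_surjective : forall v, exists w, fvert f w = v;
  cover_local_inj : forall w, {in out_edges w &, injective (fedge f)};
  cover_local_surj : forall w, fedge f @: out_edges w = out_edges (fvert f w);
  cover_transitive : forall w w', fvert f w = fvert f w' ->
    exists s : Gal, gal_vert s w = w' }.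

End Deck.

Notation free_ab T := {ffun T -> int}.

(* The basis element w of the free abelian group on T. *)
Definition dirac (T : finType) (w : T) : free_ab T := [ffun x => (x == w)%:R].

Definition lin_ext (T : finType) (M : zmodType) (g : T -> M) (D : free_ab T) : M :=
  \sum_w g w *~ D w.

Fact lin_ext_is_zmod_morphism (T : finType) (M : zmodType) (g : T -> M) :
  zmod_morphism (lin_ext g).
Proof.
move=> D E; rewrite /lin_ext -sumrB; apply: eq_bigr => w _.
by rewrite !ffunE mulrzBr.
Qed.
HB.instance Definition _ (T : finType) (M : zmodType) (g : T -> M) :=
  GRing.isZmodMorphism.Build (free_ab T) M (lin_ext g)
    (lin_ext_is_zmod_morphism g).

Notation Div Y := (free_ab (vert Y)).

Section Divisors.
Variable Y : graph.

Definition degree : Div Y -> int := lin_ext (fun=> 1).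
HB.instance Definition _ :=
  GRing.isZmodMorphism.Build (Div Y) int degree (lin_ext_is_zmod_morphism _).

Definition op_val : Div Y -> Div Y :=
  lin_ext (fun w => dirac w *+ valency w).
Definition op_adj : Div Y -> Div Y :=
  lin_ext (fun w => \sum_(e in out_edges w) dirac (targ e)).
Definition laplacian (D : Div Y) : Div Y := op_val D - op_adj D.

Fact laplacian_is_zmod_morphism : zmod_morphism laplacian.
Proof.
move=> D E; rewrite /laplacian /op_val /op_adj !raddfB /=.
exact: addrACA.
Qed.
HB.instance Definition _ :=
  GRing.isZmodMorphism.Build (Div Y) (Div Y) laplacian
    laplacian_is_zmod_morphism.

Definition degree_zero : {pred Div Y} := fun D => degree D == 0.
Fact degree_zero_closed : zmod_closed degree_zero.
Proof.
split=> [|D E]; rewrite !unfold_in; first by rewrite raddf0.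
by move=> /eqP D0 /eqP E0; rewrite raddfB /= D0 E0 subrr.
Qed.
HB.instance Definition _ := GRing.isZmodClosed.Build (Div Y) degree_zero
  degree_zero_closed.

Record Div0 := MkDiv0 { div0_val :> Div Y; div0P : div0_val \in degree_zero }.
HB.instance Definition _ := [isSub for div0_val].
HB.instance Definition _ := [Choice of Div0 by <:].
HB.instance Definition _ := [SubChoice_isSubZmodule of Div0 by <:].

Definition principal : {pred Div0} :=
  fun D => `[< exists E : Div Y, laplacian E = D >].
Fact principal_closed : zmod_closed principal.
Proof.
split=> [|D1 D2]; first by apply/asboolP; exists 0; rewrite raddf0.
move=> /asboolP[E1 e1] /asboolP[E2 e2]; apply/asboolP; exists (E1 - E2).
by rewrite raddfB /= e1 e2.
Qed.
HB.instance Definition _ := GRing.isZmodClosed.Build Div0 principal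
  principal_closed.

Definition Pic0 : zmodType := Quotient.quot principal.

End Divisors.

Section GaloisAction.
Variables (Y X : graph) (f : graph_morphism Y X).
Notation G := (Gal f).
Notation ZG := (group_alg int G).

Definition gal_div (s : G) : Div Y -> Div Y :=
  lin_ext (fun w => dirac (gal_vert s w)).

Fact gal_div0_subproof (s : G) (D : Div0 Y) :
  gal_div s D \in degree_zero (Y:=Y).
Proof.
case: D => D /=; rewrite !unfold_in => /eqP D0; apply/eqP; rewrite -{}[RHS]D0.
rewrite [gal_div s D]/lin_ext raddf_sum /=.
apply: eq_bigr => w _; rewrite raddfMz /=; congr (_ *~ _).
rewrite /degree /lin_ext (bigD1 (gal_vert s w)) //= big1 => [|x xN].
  by rewrite ffunE eqxx addr0.
by rewrite ffunE (negPf xN).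
Qed.

Definition gal_div0 (s : G) (D : Div0 Y) : Div0 Y :=
  MkDiv0 (gal_div0_subproof s D).

Definition gal_pic0 (s : G) (x : Pic0 Y) : Pic0 Y :=
  \pi_(Pic0 Y)%qT (gal_div0 s (repr x)).

Definition ZG_div (a : ZG) (D : Div Y) : Div Y := \sum_s gal_div s D *~ a s.

Definition ZG_basis (n : nat) (b : 'I_n -> Div Y) : Prop :=
  forall D, exists! c : {ffun 'I_n -> ZG}, D = \sum_i ZG_div (c i) (b i).

Definition ZG_coord n (b : 'I_n -> Div Y) (D : Div Y) : {ffun 'I_n -> ZG} :=
  xget (0 : {ffun 'I_n -> ZG})
    [set c : {ffun 'I_n -> ZG} | D = \sum_i ZG_div (c i) (b i)]%classic.

Definition ZG_mx n (b : 'I_n -> Div Y) (phi : Div Y -> Div Y) : 'M[ZG]_n :=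
  \matrix_(i, j) ZG_coord b (phi (b j)) i.

(* eta(u) = det(I - A u + (D - I) u^2), computed in the Z[G]-basis b of       *)
(* Div(Y). The Leibniz formula \det is available over any ring; it is the     *)
(* usual determinant, independent of b, when Z[G] is commutative, i.e. G is   *)
(* abelian. Bases exist by ZG_basis_exists.                                   *)
Definition eta n (b : 'I_n -> Div Y) : {poly ZG} :=
  \det (1%:M - 'X *: map_mx polyC (ZG_mx b (@op_adj Y))
        + 'X^2 *: map_mx polyC (ZG_mx b (fun D => op_val D - D))).

Definition h_at_1 n (b : 'I_n -> Div Y) (R : comUnitRingType) (psi : G -> R) : R :=
  character_ext psi (eta b).[1].

Section Primary.
Variables (p : nat) (p_pr : prime p).
Notation Zp := (padic_int p_pr).

Definition primary_part : set (Pic0 Y) :=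
  [set x | exists k, x *+ p ^ k == 0]%classic.

(* z x = (z mod p^k) x as soon as p^k x = 0; only meant for x in the          *)
(* p-primary part.                                                            *)
Definition Zp_pic0 (z : Zp) (x : Pic0 Y) : Pic0 Y :=
  if pselect (exists k, x *+ p ^ k == 0) is left h
  then x *+ z (ex_minn h) else 0.

Definition ZpG_pic0 (a : group_alg Zp G) (x : Pic0 Y) : Pic0 Y :=
  \sum_s Zp_pic0 (a s) (gal_pic0 s x).

Definition idem_part (psi : G -> Zp) : set (Pic0 Y) :=
  (ZpG_pic0 (character_idem psi) @` primary_part)%classic.

End Primary.
End GaloisAction.

Section FibreBasis.
Variables (Y X : graph) (f : graph_morphism Y X) (f_gal : galois_cover f).

Lemma gal_vert_inj (s t : Gal f) w : gal_vert s w = gal_vert t w -> s = t.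
Proof.
move=> stw; apply/val_inj; move: stw; rewrite /gal_vert.
case: s t => [[sv se] /= sP] [[tv te] /= tP] stw.
move: (sP) (tP); rewrite !inE.
case/and5P => /forallP s1 /forallP s2 _ _ /forallP s5.
case/and5P => /forallP t1 /forallP t2 _ _ /forallP t5.
have step e : sv (orig e) = tv (orig e) -> se e = te e.
  move=> ste; apply: (cover_local_inj f_gal (w := sv (orig e))).
  - by rewrite inE s1.
  - by rewrite inE ste t1.
  - by rewrite (eqP (s5 e)) (eqP (t5 e)).
have stv u : sv u = tv u.
  have /connectP[q] := cover_source_connected f_gal w u.
  elim: q w stw => [|v q IHq] w stw /=; first by move=> _ ->.
  case/andP => /existsP[e /andP[/eqP we /eqP ev]]; apply: IHq.
  by rewrite -ev -(eqP (s2 e)) -(eqP (t2 e)) step // we.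
by congr pair; apply/permP => x; rewrite ?step.
Qed.

Lemma gal_div_dirac (s : Gal f) w : gal_div s (dirac w) = dirac (gal_vert s w).
Proof.
rewrite /gal_div /lin_ext (bigD1 w) //= big1 => [|x xw].
  by rewrite addr0 ffunE eqxx.
by rewrite ffunE (negPf xw).
Qed.

Lemma fvert_gal (s : Gal f) w : fvert f (gal_vert s w) = fvert f w.
Proof.
by have := subgP s; rewrite inE => /and5P[_ _ _ /forallP/(_ w)/eqP].
Qed.

Lemma ffunMzE (T : finType) (E : free_ab T) (z : int) y : (E *~ z) y = E y * z.
Proof.
rewrite -mulrzz; case: z => n; first by rewrite -!pmulrn ffunMnE.
by rewrite NegzE !mulrNz ffunE -!pmulrn ffunMnE.
Qed.

(* Any choice of fibre representatives is a Z[G]-basis of Div(Y). *)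
Lemma fibre_basis (r : vert X -> vert Y) : cancel r (fvert f) ->
  ZG_basis f (fun i : 'I_#|vert X| => dirac (r (enum_val i))).
Proof.
move=> rK D.
have cE (c : {ffun 'I_#|vert X| -> group_alg int (Gal f)}) i s :
    (\sum_i ZG_div (c i) (dirac (r (enum_val i)))) (gal_vert s (r (enum_val i)))
      = c i s.
  rewrite sum_ffunE (bigD1 i) //= /ZG_div sum_ffunE (bigD1 s) //=.
  rewrite ffunMzE gal_div_dirac ffunE eqxx mul1r !big1 ?addr0 // => [j ji|t ts].
    rewrite sum_ffunE big1 // => t _; rewrite ffunMzE gal_div_dirac ffunE.
    case: eqP => [/(congr1 (fvert f))|]; last by rewrite mul0r.
    by rewrite !fvert_gal !rK => /enum_val_inj ij; rewrite ij eqxx in ji.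
  rewrite ffunMzE gal_div_dirac ffunE; case: eqP => [/gal_vert_inj st|].
    by rewrite st eqxx in ts.
  by rewrite mul0r.
exists [ffun i => [ffun s => D (gal_vert s (r (enum_val i)))]]; split.
  apply/ffunP => y.
  have [] := cover_transitive f_gal (w := r (fvert f y)) (w' := y).
    by rewrite rK.
  move=> s; rewrite -[in r _](enum_rankK (fvert f y)) => <-.
  by rewrite cE !ffunE.
move=> c ->; apply/ffunP => i; apply/ffunP => s; rewrite !ffunE; exact: cE.
Qed.

Lemma ZG_basis_exists : exists b : 'I_#|vert X| -> Div Y, ZG_basis f b.
Proof.
have [r rK] := choice (cover_surjective f_gal).
by exists (fun i => dirac (r (enum_val i))); exact: fibre_basis.
Qed.
End FibreBasis.

(* Main.v *)
(* Let T be the matrix over Z_p obtained by applying psi to the matrix of the *)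

(* Conceptually, $\psi$ being non-trivial, $e_\psi$ kills the trivial module $\mathbb{Z}_p$, so
   $\mathrm{Div}^0$ and $\mathrm{Div}$ have the same $\psi$-part over $\mathbb{Z}_p$. It is free on
   the $e_\psi b_i$, and the Laplacian acts on it by the matrix $T$. Hence $e_\psi A$ is the
   cokernel of $T$ on $\mathbb{Z}_p^n$, whose order is $|\det T|_p^{-1}$. The proof replaces
   tensoring with $\mathbb{Z}_p$ by integers modulo $q = p^N$. [h_at_1E] identifies the determinant,
   and [det_laplacian_neq0] shows that it is nonzero by means of [pic0_exponent].
   [character_idem_lift] gives the integral idempotent; its augmentation 0 plays the role of $e_\psi
   \mathbb{Z}_p = 0$. [lattice_class_eq], [lattice_class_idem] and [idem_part_lattice] identify
   $e_\psi A$ with $\mathbb{Z}^n/(T\mathbb{Z}^n + q\mathbb{Z}^n)$, and [card_lattice_quotient]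
   counts this quotient. *)
(* Laplacian over Z[G], so that h(1, psi) = det T. Since Pic^0(Y) has a       *)
(* nonzero exponent c, the Laplacian matrix divides the scalar c (s - 1) over *)
(* Z[G] for every s in G; choosing psi(s) <> 1 shows that det T <> 0. Modulo  *)
(* a large power q = p^N, lift e_psi to an element e of Z[G] of augmentation  *)
(* 0, and let m be the prime-to-p part of c. For a Z[G]-basis b of Div(Y) the *)
(* map sending u in Z^n to the class of m e (\sum_i u_i b_i) has image        *)
(* e_psi A, because e a = psi(a) e mod q for a in Z[G], and its kernel is     *)
(* T Z^n + q Z^n. The Smith normal form of an integral lift of T computes the *)
(* index of this lattice as the p-part of det T.                              *)
Require Import Defs.
From HB Require Import structures.
From mathcomp Require Import all_boot all_order all_algebra all_fingroup.
From mathcomp Require Import boolp classical_sets functions cardinality.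
From mathcomp Require Import ring.

Set Implicit Arguments.
Unset Strict Implicit.
Unset Printing Implicit Defensive.

Import Order.TTheory GRing.Theory Num.Theory.
Local Open Scope ring_scope.

(** * p-adic integers *)

Section PadicIntegers.
Variables (p : nat) (p_pr : prime p).
Notation Zp := (padic_int p_pr).
Implicit Types x y : Zp.

Lemma padic_res0 n : (0 : Zp) n = 0%N.
Proof. exact: mod0n. Qed.

Lemma padic_res_le x m n : (m <= n)%N -> (x n %% p ^ m)%N = x m.
Proof.
move=> /subnKC <-; elim: (n - m)%N => [|k IHk].
  by rewrite addn0 padic_res_mod.
by rewrite -IHk [x (m + k)%N]padic_resP modn_dvdm ?addnS // dvdn_exp2l ?leq_addr.
Qed.

Lemma padic_neq0P x : reflect (exists n, x n.+1 != 0%N) (x != 0).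
Proof.
apply: (iffP idP) => [|[n]]; last by apply: contraNneq => ->; rewrite padic_res0.
apply: contra_neqP => /forallNP x0; apply: padic_int_inj => -[|n].
  by rewrite padic_res0 -padic_res_mod modn1.
by rewrite padic_res0; apply/eqP; rewrite -[_ == _]negbK; exact/negP/x0.
Qed.

Lemma padic_abs_neq0 x : x != 0 ->
  exists v, [/\ padic_abs x = p%:R ^- v, x v = 0%N & x v.+1 != 0%N].
Proof.
move=> /padic_neq0P x0; rewrite /padic_abs; case: pselect => // nzx.
case: ex_minnP => -[|v] xv vP; [exists 0%N | exists v.+1]; split=> //.
  by rewrite -padic_res_mod modn1.
by apply/eqP; apply: contraTT (ltnSn v) => /vP; rewrite -leqNgt.
Qed.

(** Valuations add: if $x$ and $y$ have valuations $a$ and $b$, their residues modulo $p^{a+b+1}$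
    are $u p^a$ and $w p^b$ with $u, w$ prime to $p$, so their product is not divisible by
    $p^{a+b+1}$. *)
Lemma padic_mulf_eq0 x y : x * y = 0 -> (x == 0) || (y == 0).
Proof.
move=> xy0; apply/norP => -[/padic_abs_neq0[a [_ xa xaS]]].
move=> /padic_abs_neq0[b [_ yb ybS]].
have val (z : Zp) c N : z c = 0%N -> z c.+1 != 0%N -> (c < N)%N ->
    (p ^ c %| z N)%N && ~~ (p ^ c.+1 %| z N)%N.
  move=> zc zcS cN.
  by rewrite /dvdn !padic_res_le ?zc ?eqxx //; exact: ltnW.
set N := (a + b).+1.
have /andP[/dvdnP[u xE] nx] := val x a N xa xaS (leq_addr b a.+1).
have bN : (b < N)%N by rewrite ltnS leq_addl.
have /andP[/dvdnP[w yE] ny] := val y b N yb ybS bN.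
have: (p ^ N %| x N * y N)%N.
  by have /(congr1 (fun z : Zp => z N)) := xy0; rewrite padic_res0 => /eqP.
rewrite xE yE mulnACA -expnD /N expnSr [(u * w * _)%N]mulnC dvdn_pmul2l ?expn_gt0 ?prime_gt0 //.
rewrite Euclid_dvdM // => /orP[pu|pw]; [case/negP: nx|case/negP: ny].
  by rewrite xE expnS dvdn_mul.
by rewrite yE expnS dvdn_mul.
Qed.

Lemma padic_res_nat (k N : nat) : (k%:R : Zp) N = (k %% p ^ N)%N.
Proof.
elim: k => [|k IHk]; first by rewrite padic_res0 mod0n.
by rewrite -natr1 [LHS]/= IHk modnDm addn1.
Qed.

Lemma padic_natr_neq0 (k : nat) : (0 < k)%N -> (k%:R : Zp) != 0.
Proof.
move=> k0; apply/padic_neq0P; exists k; rewrite padic_res_nat modn_small -?lt0n //.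
by rewrite (leq_trans (ltn_expl k (prime_gt1 p_pr))) // leq_exp2l ?prime_gt1.
Qed.

(* The inverse of p - 1 is minus the sum of all the powers of p. *)
Lemma padic_predp_unit : p.-1%:R \is a @GRing.unit Zp.
Proof.
have uP n : (\sum_(i < n.+1) p ^ i = \sum_(i < n) p ^ i %[mod p ^ n])%N.
  by rewrite big_ord_recr /= modnDr.
suff H : (p.-1%:R : Zp) * padic_of_nat p_pr uP = - 1.
  by apply/unitrPr; exists (- padic_of_nat p_pr uP); rewrite mulrN H opprK.
apply/eqP; rewrite -addr_eq0; apply/eqP/padic_int_inj => n.
rewrite padic_res0 /= padic_res_nat modnMm modnDm -predn_exp addn1.
by rewrite prednK ?modnn // expn_gt0 prime_gt0.
Qed.

(** * Reduction modulo $p^N$ as a ring morphism *)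

Section Reduction.
Variable N : nat.

Lemma padic_modulus_gt1 : (0 < N)%N -> (1 < p ^ N)%N.
Proof. by move=> N_gt0; rewrite -(exp1n N) ltn_exp2r // prime_gt1. Qed.

(* The bound is an argument because 'Z_1 is Z/2, so that padic_red is a ring  *)
(* morphism only when N > 0.                                                  *)
Definition padic_red of (0 < N)%N := fun x => (x N)%:R : 'Z_(p ^ N).

Variable N_gt0 : (0 < N)%N.

Fact padic_red_zmod_morphism : zmod_morphism (padic_red N_gt0).
Proof.
suff D : {morph padic_red N_gt0 : x y / x + y}.
  by move=> x y; apply: (addIr (padic_red N_gt0 y)); rewrite -D !subrK.
by move=> x y; rewrite /padic_red -natrD -[RHS]Zp_nat_mod ?padic_modulus_gt1.
Qed.

Fact padic_red_monoid_morphism : monoid_morphism (padic_red N_gt0).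
Proof.
split=> [|x y]; first by rewrite /padic_red /= Zp_nat_mod ?padic_modulus_gt1.
by rewrite /padic_red -natrM -[RHS]Zp_nat_mod ?padic_modulus_gt1.
Qed.

HB.instance Definition _ := GRing.isZmodMorphism.Build Zp 'Z_(p ^ N)
  (padic_red N_gt0) padic_red_zmod_morphism.
HB.instance Definition _ := GRing.isMonoidMorphism.Build Zp 'Z_(p ^ N)
  (padic_red N_gt0) padic_red_monoid_morphism.

End Reduction.
End PadicIntegers.

Lemma intr_Zp_eq0 (q : nat) (z : int) : (1 < q)%N ->
  (z%:~R == 0 :> 'Z_q) = (q%:Z %| z)%Z.
Proof.
move=> q1; have natE k : (k%:R == 0 :> 'Z_q) = (q %| k)%N.
  by rewrite -(inj_eq val_inj) /= val_Zp_nat.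
case: z => k; first by rewrite -pmulrn natE dvdzE.
by rewrite NegzE mulrNz oppr_eq0 -pmulrn natE dvdzE abszN.
Qed.

Lemma intr_Zp_eq (q : nat) (y z : int) : (1 < q)%N ->
  (y%:~R == z%:~R :> 'Z_q) = (q%:Z %| y - z)%Z.
Proof. by move=> q1; rewrite -intr_Zp_eq0 // intrB subr_eq0. Qed.

(** * Quotients of Z^n *)

(** This lattice depends only on $T$ modulo $q$, so an integral lift can stand for a $p$-adic
    matrix. *)
Definition col_lattice n (q : nat) (T : 'M[int]_n) (x : 'cV[int]_n) : Prop :=
  exists y z : 'cV[int]_n, x = T *m y + q%:Z *: z.

Lemma logn_prod_abs (p : nat) (I : Type) (r : seq I) (d : I -> int) :
    (forall i, d i != 0) ->
  logn p `|(\prod_(i <- r) d i)%R|%N = (\sum_(i <- r) logn p `|d i|)%N.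
Proof.
move=> d0; elim: r => [|i r IHr]; first by rewrite !big_nil logn1.
rewrite !big_cons abszM lognM ?IHr ?absz_gt0 //.
by elim/big_ind: _ => //; exact: mulf_neq0.
Qed.

(** As the valuation of $d$ is at most $N$, it is also that of $\gcd(d, p^N)$, a power of $p$. *)
Lemma Bezout_pfactor (p N : nat) (d y : int) : prime p -> d != 0 ->
    (logn p `|d| <= N)%N -> ((p ^ logn p `|d|)%N %| y)%Z ->
  exists s t, y = d * s + (p ^ N)%N%:Z * t.
Proof.
move=> p_pr d0 wN py; have [s [t]] := Bezoutz d (p ^ N)%N.
have -> : gcdz d (p ^ N)%N = (p ^ logn p `|d|)%N.
  rewrite /gcdz /=; congr Posz; have d_gt0 : (0 < `|d|)%N by rewrite absz_gt0.
  have [m pm dE] := pfactor_coprime p_pr d_gt0.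
  rewrite {1}dE -{1}(subnK wN) expnD -muln_gcdl.
  by rewrite (eqP (_ : coprime m _)) ?mul1n // coprime_sym coprimeXl.
have /dvdzP[u ->] := py => <-.
by exists (u * s), (u * t); rewrite mulrDr [d * _]mulrC [_%:Z * _]mulrC !mulrA.
Qed.

(** In Smith coordinates the lattice is the product of the ideals $d_i\mathbb{Z} + p^N\mathbb{Z} =
    p^{w_i}\mathbb{Z}$. The $w_i$ sum to $v$, and the boxes $[0, p^{w_i})$ provide the
    representatives. *)
Lemma card_lattice_quotient (p n N v : nat) (T : 'M[int]_n) : prime p ->
    (v <= N)%N -> ((p ^ v)%N %| \det T)%Z -> ~~ ((p ^ v.+1)%N %| \det T)%Z ->
  exists (I : finType) (rep : I -> 'cV[int]_n), [/\ #|I| = (p ^ v)%N,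
    forall i j, col_lattice (p ^ N) T (rep i - rep j) -> i = j &
    forall x, exists i, col_lattice (p ^ N) T (x - rep i)].
Proof.
move=> p_pr vN pv pvS.
have [L Lu [R Ru [d0 _ TE]]] := int_Smith_normal_form T.
(* An index beyond the end of [d0] would give 0, which [d_neq0] excludes. *)
pose d (i : 'I_n) := d0`_i; set D := (\matrix_(i, j) _) in TE.
have DE y i : (D *m y) i 0 = d i * (y : 'cV_n) i 0.
  rewrite mxE (bigD1 i) //= big1 ?addr0 => [|j ji]; rewrite mxE ?eqxx //.
  by rewrite (inj_eq val_inj) eq_sym (negPf ji) mulr0n mul0r.
have detT : \det T = \det L * (\prod_i d i) * \det R.
  rewrite TE !det_mulmx; congr (_ * _ * _).
  have -> : D = diag_mx (\row_i d i).
    by apply/matrixP => i j; rewrite !mxE (inj_eq val_inj).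
  by rewrite det_diag; apply: eq_bigr => i _; rewrite mxE.
have absdet : `|\det T|%N = `|(\prod_i d i)%R|%N.
  have unit1 A : A \in unitmx -> `|\det A|%N = 1%N.
    by rewrite unitmxE => /orP[] /eqP->.
  by rewrite detT !abszM !unit1 // mul1n muln1.
have detT0 : \det T != 0 by apply: contraNneq pvS => ->; rewrite dvdz0.
have d_neq0 i : d i != 0.
  have: \prod_i d i != 0 by rewrite -absz_eq0 -absdet absz_eq0.
  by move=> /prodf_neq0; apply.
pose w i := logn p `|d i|.
have sumw : (\sum_i w i = v)%N.
  rewrite -logn_prod_abs // -absdet; apply/eqP; rewrite eqn_leq.
  rewrite -pfactor_dvdn ?absz_gt0 // [X in _ && X]pv andbT leqNgt.
  by rewrite -pfactor_dvdn ?absz_gt0.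
have wN i : (w i <= N)%N.
  by rewrite (leq_trans _ vN) // -sumw (bigD1 i) //= leq_addr.
have LP y : col_lattice (p ^ N) T (L *m y) <-> forall i, ((p ^ w i)%N %| y i ord0)%Z.
  split=> [[a [z E]] i|pwy].
    have -> : y = D *m (R *m a) + (p ^ N)%N%:Z *: (invmx L *m z).
      rewrite scalemxAr -[y](mulKmx Lu) E TE mulmxDr -!mulmxA mulKmx //.
    rewrite mxE DE [X in _ + X]mxE; apply: rpredD; apply: dvdz_mulr.
      by rewrite dvdzE pfactor_dvdnn.
    by rewrite dvdzE dvdn_exp2l.
  have st i : exists u : int * int, y i 0 = d i * u.1 + (p ^ N)%N%:Z * u.2.
    by have [s [t E]] := Bezout_pfactor p_pr (d_neq0 i) (wN i) (pwy i); exists (s, t).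
  have [u uE] := choice st.
  exists (invmx R *m (\col_i (u i).1)), (L *m (\col_i (u i).2)).
  rewrite TE -!mulmxA mulKVmx // scalemxAr -mulmxDr; congr (_ *m _).
  by apply/colP => i; rewrite mxE DE !mxE uE.
exists {dffun forall i : 'I_n, 'I_(p ^ w i)}.
exists (fun f : {dffun forall i : 'I_n, 'I_(p ^ w i)} => L *m \col_i (f i : nat)%:Z).
split=> [|f g|x].
- rewrite card_dep_ffun foldrE big_map big_enum /= -sumw expn_sum.
  by apply: eq_bigr => i _; rewrite card_ord.
- rewrite -mulmxBr => /LP fg; apply/ffunP => i; apply/val_inj/eqP => /=.
  have := fg i; rewrite !mxE -eqz_mod_dvd !modz_nat eqz_nat !modn_small //.
have pw_gt0 i : (0 < (p ^ w i)%N :> int) by rewrite ltz_nat expn_gt0 prime_gt0.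
pose y := invmx L *m x; pose c i := (y i ord0 %% (p ^ w i)%N)%Z.
have c_ge0 i : 0 <= c i by rewrite modz_ge0 // gt_eqF.
have c_lt i : (`|c i| < p ^ w i)%N by rewrite -ltz_nat gez0_abs // ltz_pmod.
exists [ffun i => Ordinal (c_lt i)].
rewrite -[x](mulKVmx Lu) -mulmxBr; apply/LP => i.
by rewrite mxE [X in _ + X]mxE [X in - X]mxE ffunE /= gez0_abs // -eqz_mod_dvd modz_mod.
Qed.

(** * The Laplacian of a graph *)

Section FreeAbelian.
Variable T : finType.

Lemma free_ab_sum (D : free_ab T) : D = \sum_w dirac w *~ D w.
Proof.
apply/ffunP => x; rewrite sum_ffunE (bigD1 x) //= big1 => [|y yx].
  by rewrite Defs.ffunMzE ffunE eqxx mul1r addr0.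
by rewrite Defs.ffunMzE ffunE eq_sym (negPf yx) mul0r.
Qed.

Lemma lin_ext_dirac (M : zmodType) (g : T -> M) w : lin_ext g (dirac w) = g w.
Proof.
rewrite /lin_ext (bigD1 w) //= big1 => [|x xw]; first by rewrite ffunE eqxx addr0 mulr1z.
by rewrite ffunE (negPf xw) mulr0z.
Qed.

Lemma additive_dirac_sum (M : zmodType) (F : {additive free_ab T -> M}) D :
  F D = \sum_w F (dirac w) *~ D w.
Proof.
rewrite {1}(free_ab_sum D) raddf_sum; apply: eq_bigr => w _.
by rewrite raddfMz.
Qed.

Lemma eq_additive_dirac (M : zmodType) (F H : {additive free_ab T -> M}) :
  (forall w, F (dirac w) = H (dirac w)) -> F =1 H.
Proof.
by move=> FH D; rewrite !additive_dirac_sum; apply: eq_bigr => w _; rewrite FH.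
Qed.

End FreeAbelian.

Section Laplacian.
Variable Y : graph.
Implicit Types D E : Div Y.

Lemma laplacian_dirac w : laplacian (dirac w) =
  dirac w *+ valency w - \sum_(e in out_edges w) dirac (targ e) :> Div Y.
Proof. by rewrite /laplacian /op_val /op_adj !lin_ext_dirac. Qed.

Lemma op_val_sumE D x : op_val D x = \sum_(e : edge Y | orig e == x) D (orig e).
Proof.
rewrite /op_val /lin_ext sum_ffunE (bigD1 x) //= big1 => [|w wx].
  rewrite Defs.ffunMzE ffunMnE ffunE eqxx addr0 mulr_natl.
  under eq_bigr => e /eqP-> do over.
  by rewrite sumr_const /valency cardsE.
by rewrite Defs.ffunMzE ffunMnE ffunE eq_sym (negPf wx) mul0rn mul0r.
Qed.

Lemma op_adj_sumE D x : op_adj D x = \sum_(e : edge Y | targ e == x) D (orig e).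
Proof.
rewrite /op_adj /lin_ext sum_ffunE.
under eq_bigr do rewrite Defs.ffunMzE sum_ffunE mulr_suml.
rewrite (exchange_big_dep predT) //= [RHS]big_mkcond; apply: eq_bigr => e _ /=.
rewrite (big_pred1 (orig e)) => [|w]; last by rewrite inE eq_sym.
by rewrite ffunE eq_sym; case: eqP => _; rewrite ?mul1r ?mul0r.
Qed.

Lemma ebar_bij : bijective (@ebar Y).
Proof. by exists (@ebar Y); exact: ebarK. Qed.

(** The valency term can be summed over origins or, through [ebar], over targets; using one of each
    completes the squares. Both orientations of an edge occur, hence the factor 2. *)
Lemma dirichlet_form D :
  (\sum_x D x * laplacian D x) *+ 2 = \sum_(e : edge Y) (D (orig e) - D (targ e)) ^+ 2.
Proof.
have valE : \sum_x D x * op_val D x = \sum_(e : edge Y) D (orig e) ^+ 2.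
  rewrite (partition_big (@orig Y) predT) //=; apply: eq_bigr => x _.
  by rewrite op_val_sumE mulr_sumr; apply: eq_bigr => e /eqP->.
have adjE : \sum_x D x * op_adj D x = \sum_(e : edge Y) D (orig e) * D (targ e).
  rewrite (partition_big (@targ Y) predT) //=; apply: eq_bigr => x _.
  by rewrite op_adj_sumE mulr_sumr; apply: eq_bigr => e /eqP->; rewrite mulrC.
have valE' : \sum_x D x * op_val D x = \sum_(e : edge Y) D (targ e) ^+ 2.
  rewrite valE (reindex (@ebar Y)) /=; last exact: onW_bij ebar_bij.
  by apply: eq_bigr => e _; rewrite orig_bar.
have -> : \sum_x D x * laplacian D x =
          \sum_x D x * op_val D x - \sum_x D x * op_adj D x.
  by rewrite -sumrB; apply: eq_bigr => x _; rewrite /laplacian !ffunE mulrBr.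
rewrite mulr2n {1}valE valE' adjE -!sumrB -big_split /=.
by apply: eq_bigr => e _; ring.
Qed.

Lemma degreeE D : degree D = \sum_x D x.
Proof. by rewrite /degree /lin_ext; apply: eq_bigr => x _; rewrite intz. Qed.

Lemma degree_dirac (w : vert Y) : degree (dirac w) = 1.
Proof. exact: lin_ext_dirac. Qed.

Lemma degree_laplacian D : degree (laplacian D) = 0.
Proof.
pose F : {additive Div Y -> int} := @degree Y \o @laplacian Y.
pose Z : {additive Div Y -> int} := \0.
apply: (@eq_additive_dirac _ _ F Z) => w /=.
rewrite laplacian_dirac raddfB raddfMn (raddf_sum (@degree Y)) /= degree_dirac.
under eq_bigr do rewrite degree_dirac.
by rewrite sumr_const subrr.
Qed.

Hypothesis Y_connected : connected_graph Y.

(** The Dirichlet form vanishes, so [D] is constant along each edge, hence along paths. *)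
Lemma harmonic_constant D : laplacian D = 0 -> forall v w, D v = D w.
Proof.
move=> D0; have: \sum_(e : edge Y) (D (orig e) - D (targ e)) ^+ 2 = 0.
  by rewrite -dirichlet_form D0 big1 ?mul0rn // => x _; rewrite ffunE mulr0.
move=> /eqP; rewrite psumr_eq0 => [|e _]; last exact: sqr_ge0.
move=> /allP D_edge v w; have /connectP[q] := Y_connected v w.
elim: q v => [|u q IHq] v /=; first by move=> _ ->.
case/andP => /existsP[e /andP[/eqP <- /eqP <-]] qP wq; rewrite -(IHq _ qP wq).
have /implyP := D_edge e (mem_index_enum _).
by rewrite sqrf_eq0 subr_eq0 => /(_ isT)/eqP.
Qed.

(* The determinant of the Laplacian plus the all-ones matrix is a nonzero     *)
(* exponent of Pic^0.                                                         *)
Lemma pic0_exponent : exists2 c : int, c != 0 &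
  forall D, degree D = 0 -> exists E, laplacian E = D *~ c.
Proof.
pose n := #|vert Y|; pose ev (i : 'I_n) : vert Y := enum_val i.
pose M : 'M[int]_n := \matrix_(i, j) (laplacian (dirac (ev j)) (ev i) + 1).
pose vec (u : 'cV[int]_n) : Div Y := [ffun w => u (enum_rank w) 0].
have ME u i : (M *m u) i 0 = laplacian (vec u) (ev i) + degree (vec u).
  rewrite degreeE (additive_dirac_sum (@laplacian Y)) sum_ffunE -big_split /=.
  rewrite mxE (reindex (@enum_rank (vert Y))) /=; last exact/onW_bij/enum_rank_bij.
  apply: eq_bigr => w _; rewrite mxE /ev enum_rankK Defs.ffunMzE [vec u w]ffunE.
  by rewrite mulrDl mul1r.
have vecM u w : (M *m u) (enum_rank w) 0 = laplacian (vec u) w + degree (vec u).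
  by rewrite ME /ev enum_rankK.
(* The Laplacian has image in degree 0, so summing the entries of $Mu$ over the $n$ vertices leaves
   $n$ times the degree of $u$. *)
have degM u x : (forall w, (M *m u) (enum_rank w) 0 = x w) -> \sum_w x w = 0 ->
    degree (vec u) = 0.
  move=> Mux x0; have /eqP: degree (vec u) *+ n = 0.
    rewrite -[LHS]add0r -{1}(degree_laplacian (vec u)) degreeE -sumr_const -big_split.
    rewrite -[RHS]x0; apply: eq_bigr => w _. by rewrite /= -vecM Mux.
  rewrite mulrn_eq0 => /orP[/eqP n0|/eqP//].
  by rewrite degreeE big1 // => w; case: (fintype0 w n0).
exists (\det M) => [|D D0].
  (* A kernel vector has degree 0, hence is harmonic, hence constant, and a constant of degree 0
     vanishes. *)
  rewrite -det_tr; apply/det0P => -[u' /eqP u'0]; rewrite -[u']trmxK -trmx_mul.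
  move=> /(congr1 trmx); rewrite trmxK trmx0; set u := u'^T => Mu; case: u'0.
  suff u0 : u = 0 by rewrite -[u']trmxK -/u u0 trmx0.
  have deg0 : degree (vec u) = 0.
    by apply: (degM u (fun=> 0)) => [w|]; rewrite ?Mu ?mxE ?big1.
  have /harmonic_constant vecC : laplacian (vec u) = 0.
    by apply/ffunP => w; rewrite [RHS]ffunE -[LHS]addr0 -deg0 -vecM Mu mxE.
  apply/colP => i; rewrite [RHS]mxE; move/eqP: deg0; rewrite degreeE.
  under eq_bigr => w _ do rewrite (vecC w (ev i)) ffunE enum_valK.
  by rewrite sumr_const mulrn_eq0 => /orP[/eqP/(fintype0 (ev i))|/eqP].
(* The adjugate solves $Mu = \det(M) D$; since $D$ has degree 0, so does $u$, and the all-ones term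
   disappears. *)
pose u := \adj M *m \col_i D (ev i); exists (vec u); apply/ffunP => w.
have Mu x : (M *m u) (enum_rank x) 0 = \det M * D x.
  by rewrite /u mulmxA mul_mx_adj mul_scalar_mx !mxE /ev enum_rankK.
rewrite Defs.ffunMzE mulrC -Mu vecM (degM u _ Mu) ?addr0 //.
by rewrite -mulr_sumr -degreeE D0 mulr0.
Qed.

End Laplacian.

(** * The group algebra action *)

Section GroupAlgebraFacts.
Variables (gT : finGroupType).
Notation ZG := (group_alg int gT).

Definition group_elt (s : gT) : ZG := [ffun g => (g == s)%:R].

Definition augmentation (a : ZG) : int := \sum_s a s.

Lemma group_algMzE (a : ZG) (z : int) s : (a *~ z) s = a s * z.
Proof. exact: Defs.ffunMzE. Qed.

Section Character.
Variables (R : comUnitRingType) (psi : gT -> R) (psi_char : is_character psi).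

Fact character_ext_zmod_morphism : zmod_morphism (character_ext psi).
Proof.
move=> a c; rewrite /character_ext -sumrB; apply: eq_bigr => s _.
by rewrite !ffunE mulrzBr.
Qed.

Fact character_ext_monoid_morphism : monoid_morphism (character_ext psi).
Proof.
split=> [|a c].
  rewrite /character_ext (bigD1 1%g) //= big1 => [|s s1].
    by rewrite ffunE eqxx addr0 (character1 psi_char).
  by rewrite ffunE (negPf s1) mulr0z.
rewrite /character_ext mulr_suml; under eq_bigr do rewrite ffunE mulrz_sumr.
rewrite exchange_big; apply: eq_bigr => h _ /=.
rewrite mulr_sumr (reindex_inj (mulgI h)); apply: eq_bigr => k _ /=.
rewrite mulKg (characterM psi_char) mulrzAl mulrzAr -mulrzA.
by congr (_ *~ _); rewrite mulrC.
Qed.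

(** Translation by [s] multiplies the sum by [psi s], so the sum is killed by the nonzero factor
    [psi s - 1]. *)
Lemma character_sum0 s :
  psi s != 1 -> (forall x y : R, x * y = 0 -> (x == 0) || (y == 0)) ->
  \sum_g psi g = 0.
Proof.
move=> s1 dom; apply/eqP; have: (psi s - 1) * \sum_g psi g = 0.
  rewrite mulrBl mul1r mulr_sumr [X in _ - X](reindex_inj (mulgI s)) -sumrB.
  by rewrite big1 // => g _; rewrite (characterM psi_char) subrr.
by move=> /dom; rewrite subr_eq0 (negPf s1).
Qed.

End Character.
End GroupAlgebraFacts.

Section GaloisDivisors.
Variables (Y X : graph) (f : graph_morphism Y X).
Notation G := (Gal f).
Notation ZG := (group_alg int G).
Implicit Types (s t : G) (D E : Div Y) (a c : ZG).

HB.instance Definition _ s :=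
  GRing.isZmodMorphism.Build (Div Y) (Div Y) (gal_div s)
    (lin_ext_is_zmod_morphism _).

Lemma gal_divE s D w : gal_div s D (gal_vert s w) = D w.
Proof.
rewrite (additive_dirac_sum (gal_div s)) sum_ffunE {2}(free_ab_sum D) sum_ffunE.
apply: eq_bigr => v _; rewrite !Defs.ffunMzE /= gal_div_dirac !ffunE.
by rewrite (inj_eq perm_inj).
Qed.

Lemma gal_vert_surj s x : exists w, x = gal_vert s w.
Proof. by exists ((gal_vert s)^-1%g x); rewrite permKV. Qed.

Lemma degree_gal_div s D : degree (gal_div s D) = degree D.
Proof.
rewrite !degreeE (reindex_inj (@perm_inj _ (gal_vert s))).
by apply: eq_bigr => w _; rewrite gal_divE.
Qed.

Lemma laplacian_gal_div s D : laplacian (gal_div s D) = gal_div s (laplacian D).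
Proof.
have := subgP s; rewrite inE => /and5P[/forallP so /forallP st _ _ _].
apply/ffunP => x; have [w ->] := gal_vert_surj s x; rewrite gal_divE /laplacian ![(_ - _ : Div Y) _]ffunE.
rewrite ![(- _ : Div Y) _]ffunE !op_val_sumE !op_adj_sumE.
by congr (_ - _); rewrite (reindex_inj (@perm_inj _ (sgval s).2)) /=;
  apply: eq_big => e; rewrite ?(eqP (so e)) ?(eqP (st e)) ?(inj_eq perm_inj) //;
  rewrite gal_divE.
Qed.

Fact ZG_div_zmod_morphism a : zmod_morphism (ZG_div a : Div Y -> Div Y).
Proof.
move=> D E; rewrite /ZG_div -sumrB; apply: eq_bigr => s _.
by rewrite raddfB mulrzBl.
Qed.

HB.instance Definition _ a :=
  GRing.isZmodMorphism.Build (Div Y) (Div Y) (ZG_div a) (ZG_div_zmod_morphism a).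

Lemma ZG_divBl a c D : ZG_div (a - c) D = ZG_div a D - ZG_div c D.
Proof.
rewrite /ZG_div -sumrB; apply: eq_bigr => s _.
by rewrite !ffunE mulrzBr.
Qed.

Lemma ZG_divMzl a (z : int) D : ZG_div (a *~ z) D = ZG_div a D *~ z.
Proof.
rewrite /ZG_div mulrz_suml; apply: eq_bigr => s _.
by rewrite group_algMzE mulrzA.
Qed.

Lemma ZG_div_group_elt s D : ZG_div (group_elt s) D = gal_div s D.
Proof.
rewrite /ZG_div (bigD1 s) //= big1 => [|t ts]; first by rewrite ffunE eqxx addr0.
by rewrite ffunE (negPf ts).
Qed.

Lemma ZG_div1 D : ZG_div (1 : ZG) D = D.
Proof.
rewrite -[1 : ZG]/(group_elt 1%g) ZG_div_group_elt; apply/ffunP => w.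
by rewrite -[in LHS](perm1 w) -[(1 : {perm _})%g]/(gal_vert (1 : G)%g) gal_divE.
Qed.

Lemma ZG_div_subr1 s D : ZG_div (group_elt s - 1) D = gal_div s D - D.
Proof. by rewrite ZG_divBl; congr (_ - _); [exact: ZG_div_group_elt | exact: ZG_div1]. Qed.

Lemma degree_ZG_div a D : degree (ZG_div a D) = degree D * augmentation a.
Proof.
rewrite /ZG_div (raddf_sum (@degree Y)) mulr_sumr; apply: eq_bigr => s _.
by rewrite raddfMz /= degree_gal_div mulrzz.
Qed.

Lemma laplacian_ZG_div a D : laplacian (ZG_div a D) = ZG_div a (laplacian D).
Proof.
rewrite /ZG_div (raddf_sum (@laplacian Y)); apply: eq_bigr => s _.
by rewrite raddfMz /= laplacian_gal_div.
Qed.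

Hypothesis G_abelian : forall s t : G, (s * t = t * s)%g.

(** Permutations compose from left to right, so [gal_div] is naturally a right action; commutativity
    turns it into a left one. *)
Lemma gal_divM s t D : gal_div (s * t)%g D = gal_div s (gal_div t D).
Proof.
rewrite G_abelian; apply/ffunP => x; have [y ->] := gal_vert_surj s x.
have [w ->] := gal_vert_surj t y; rewrite !gal_divE.
have -> : gal_vert s (gal_vert t w) = gal_vert (t * s)%g w.
  by rewrite /gal_vert [RHS]permM.
exact: gal_divE.
Qed.

Lemma ZG_divM a c D : ZG_div (a * c) D = ZG_div a (ZG_div c D).
Proof.
rewrite /ZG_div; under eq_bigr do rewrite ffunE mulrz_sumr.
rewrite exchange_big; apply: eq_bigr => h _ /=.
rewrite (raddf_sum (gal_div h)) mulrz_suml (reindex_inj (mulgI h)).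
apply: eq_bigr => k _ /=.
by rewrite mulKg raddfMz /= gal_divM -mulrzA mulrC.
Qed.

End GaloisDivisors.

(** * The Laplacian matrix over the group algebra *)

(* The proof that psi is a character is an argument so that the ring morphism *)
(* structure can be inferred.                                                 *)
Definition char_ext (R : comUnitRingType) (gT : finGroupType) (psi : gT -> R)
  (psi_char : is_character psi) : group_alg int gT -> R := character_ext psi.

HB.instance Definition _ (R : comUnitRingType) (gT : finGroupType)
    (psi : gT -> R) (psi_char : is_character psi) :=
  GRing.isZmodMorphism.Build (group_alg int gT) R (@char_ext R gT psi psi_char)
    (character_ext_zmod_morphism psi).
HB.instance Definition _ (R : comUnitRingType) (gT : finGroupType)
    (psi : gT -> R) (psi_char : is_character psi) :=
  GRing.isMonoidMorphism.Build (group_alg int gT) R (@char_ext R gT psi psi_char)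
    (character_ext_monoid_morphism psi_char).

Lemma char_ext_group_elt (R : comUnitRingType) (gT : finGroupType) (psi : gT -> R)
  (psi_char : is_character psi) s : char_ext psi_char (group_elt s) = psi s.
Proof.
rewrite /char_ext /character_ext (bigD1 s) //= big1 => [|t ts].
  by rewrite ffunE eqxx addr0.
by rewrite ffunE (negPf ts).
Qed.

Lemma char_ext_subr1 (R : comUnitRingType) (gT : finGroupType) (psi : gT -> R)
  (psi_char : is_character psi) s :
  char_ext psi_char (group_elt s - 1) = psi s - 1.
Proof.
rewrite (raddfB (char_ext psi_char)).
by congr (_ - _); [exact: char_ext_group_elt | exact: rmorph1].
Qed.

Section LaplacianMatrix.
Variables (Y X : graph) (f : graph_morphism Y X).
Notation G := (Gal f).
Notation ZG := (group_alg int G).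
Hypothesis G_abelian : forall s t : G, (s * t = t * s)%g.
Variables (n : nat) (b : 'I_n -> Div Y).
Hypothesis b_basis : ZG_basis f b.

Lemma ZG_coordK (D : Div Y) : \sum_i ZG_div (ZG_coord f b D i) (b i) = D.
Proof.
apply/esym; have [c [cP _]] := b_basis D.
exact: (xgetPex 0 (P := fun c : {ffun 'I_n -> ZG} => _) (ex_intro _ c cP)).
Qed.

Lemma ZG_basis_inj (c d : 'I_n -> ZG) :
  \sum_i ZG_div (c i) (b i) = \sum_i ZG_div (d i) (b i) -> c =1 d.
Proof.
have [c0 [_ uniq]] := b_basis (\sum_i ZG_div (c i) (b i)).
have finE d' : \sum_i ZG_div (finfun d' i) (b i) = \sum_i ZG_div (d' i : ZG) (b i).
  by apply: eq_bigr => i _; rewrite ffunE.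
move=> cd i; have := uniq (finfun c); rewrite finE => /(_ erefl) cE.
have := uniq (finfun d); rewrite finE => /(_ cd).
by rewrite cE => /ffunP/(_ i); rewrite !ffunE.
Qed.

Lemma ZG_coordP (D : Div Y) (c : 'I_n -> ZG) :
  D = \sum_i ZG_div (c i) (b i) -> ZG_coord f b D =1 c.
Proof. by move=> Dc; apply: ZG_basis_inj; rewrite ZG_coordK. Qed.

Lemma ZG_coordB D E i : ZG_coord f b (D - E) i = ZG_coord f b D i - ZG_coord f b E i.
Proof.
move: i; apply: ZG_coordP; under eq_bigr do rewrite ZG_divBl.
by rewrite sumrB !ZG_coordK.
Qed.

Lemma ZG_coord_basis i j : ZG_coord f b (b j) i = (i == j)%:R.
Proof.
move: i; apply: ZG_coordP; rewrite (bigD1 j) //= eqxx ZG_div1 big1 ?addr0 // => i.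
by move=> /negPf->; rewrite mulr0n /ZG_div big1 // => s _; rewrite ffunE.
Qed.

Notation L := (ZG_mx f b (@laplacian Y)).

Lemma laplacian_coord (d : 'I_n -> ZG) :
  laplacian (\sum_j ZG_div (d j) (b j)) =
  \sum_i ZG_div (\sum_j d j * L i j) (b i).
Proof.
have sumE i : ZG_div (\sum_j d j * L i j) (b i) = \sum_j ZG_div (d j * L i j) (b i).
  rewrite /ZG_div [RHS]exchange_big; apply: eq_bigr => s _ /=.
  by rewrite sum_ffunE mulrz_sumr.
under [RHS]eq_bigr do rewrite sumE.
rewrite [RHS]exchange_big (raddf_sum (@laplacian Y)).
apply: eq_bigr => j _ /=.
rewrite laplacian_ZG_div -[in LHS](ZG_coordK (laplacian (b j))).
rewrite (raddf_sum (ZG_div (d j))); apply: eq_bigr => i _.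
by rewrite ZG_divM // mxE.
Qed.

Section Determinant.
Variables (R : comUnitRingType) (psi : G -> R) (psi_char : is_character psi).
Notation chi := (char_ext psi_char).

(** At $u = 1$ the matrix is $I - A + (D - I)$, the Laplacian. Evaluation is made after [chi], over
    the commutative ring [R], where it is a ring morphism and so commutes with the determinant. *)
Lemma h_at_1E : h_at_1 b psi = \det (map_mx chi L).
Proof.
pose ev : {rmorphism {poly ZG} -> R} := horner_eval 1 \o map_poly chi.
have evC (a : ZG) : ev a%:P = chi a.
  by rewrite /ev /= /horner_eval map_polyC hornerC.
have evX : ev 'X = 1 by rewrite /ev /= /horner_eval map_polyX hornerX.
have -> : h_at_1 b psi = ev (Defs.eta f b).
  by rewrite /h_at_1 -[character_ext _ _]/(chi _) -horner_map rmorph1.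
rewrite /Defs.eta -det_map_mx; congr (\det _); apply/matrixP => i j.
rewrite !mxE rmorphD rmorphB (rmorphM ev 'X) (rmorphM ev 'X^2) (rmorphXn ev).
rewrite evX !evC expr1n !mul1r rmorph_nat /laplacian !ZG_coordB !rmorphB /=.
by rewrite ZG_coord_basis rmorph_nat addrC addrA subrK.
Qed.

(** Each $(s-1)b_j$ has degree 0, so $c(s-1)b_j$ is principal. This yields $B$ with $\chi(L)\chi(B)
    = (\psi(s)-1)c \cdot I$, a nonzero scalar matrix over a ring without zero divisors. *)
Lemma det_laplacian_neq0 s : connected_graph Y -> psi s != 1 ->
    (forall x y : R, x * y = 0 -> (x == 0) || (y == 0)) ->
    (forall k : nat, (0 < k)%N -> k%:R != 0 :> R) ->
  \det (map_mx chi L) != 0.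
Proof.
move=> Y_conn s1 dom char0; have [c c0 cP] := pic0_exponent Y_conn.
have EP j : exists E, laplacian E = ZG_div (group_elt s - 1) (b j) *~ c.
  apply: cP; rewrite ZG_div_subr1 (raddfB (@degree Y)) /=.
  by rewrite degree_gal_div subrr.
have [E LE] := choice EP; pose B : 'M[ZG]_n := \matrix_(k, j) ZG_coord f b (E j) k.
have LB : map_mx chi L *m map_mx chi B = ((psi s - 1) * c%:~R)%:M.
  apply/matrixP => i j; rewrite !mxE.
  have /ZG_basis_inj/(_ i)/(congr1 chi) :
      \sum_i ZG_div (\sum_k B k j * L i k) (b i) =
      \sum_i ZG_div ((group_elt s - 1) *~ c *+ (i == j)) (b i).
    rewrite -laplacian_coord; under eq_bigr do rewrite mxE.
    rewrite ZG_coordK LE [RHS](bigD1 j) //= eqxx big1 ?addr0.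
      by rewrite ZG_divMzl.
    by move=> k /negPf->; rewrite mulr0n /ZG_div big1 // => t _; rewrite ffunE.
  rewrite (raddf_sum chi) (raddfMn chi) (raddfMz chi) /= char_ext_subr1 -mulrzr => <-; apply: eq_bigr => k _.
  by rewrite rmorphM !mxE mulrC.
have c_neq0 : (c%:~R : R) != 0.
  have [k [k0 cE]] : exists k : nat, (0 < k)%N /\ (c%:~R = k%:R :> R \/ c%:~R = - k%:R :> R).
    exists `|c|%N; rewrite absz_gt0; split=> //.
    by case: (c) => m; [left | right; rewrite NegzE mulrNz].
  by case: cE => ->; rewrite ?oppr_eq0 char0.
have dom_expr (x : R) k : x != 0 -> x ^+ k != 0.
  move=> x0; elim: k => [|k IHk]; first exact: oner_neq0.
  by rewrite exprS; apply: contraNneq x0 => /dom; rewrite (negPf IHk) orbF.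
apply: contraTneq (isT) => L0; have := congr1 determinant LB.
rewrite det_mulmx L0 mul0r det_scalar => /esym/eqP/negPn/negP; case; apply: dom_expr.
by apply: contraTneq (isT) => /dom; rewrite subr_eq0 (negPf s1) (negPf c_neq0).
Qed.

End Determinant.
End LaplacianMatrix.

(** * Pic^0 *)

Section PrincipalDivisors.
Variable Y : graph.

(** This version of [principal] lives in [Div Y], so that sums can be treated termwise without
    proofs of degree 0. *)
Definition lap_image : {pred Div Y} := fun D => `[< exists E, laplacian E = D >].

Fact lap_image_closed : zmod_closed lap_image.
Proof.
split=> [|D1 D2]; first by apply/asboolP; exists 0; rewrite raddf0.
move=> /asboolP[E1 e1] /asboolP[E2 e2]; apply/asboolP; exists (E1 - E2).
by rewrite raddfB /= e1 e2.
Qed.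

HB.instance Definition _ := GRing.isZmodClosed.Build (Div Y) lap_image
  lap_image_closed.

Lemma lap_imageP (D : Div Y) :
  reflect (exists E, laplacian E = D) (D \in lap_image).
Proof. exact: asboolP. Qed.

Lemma lap_imageMz (D : Div Y) (z : int) : D \in lap_image -> D *~ z \in lap_image.
Proof. by move=> DI; case: z => k; rewrite ?NegzE ?mulrNz ?rpredN rpredMn. Qed.

Lemma pic0_eqP (D E : Div0 Y) :
  \pi_(Pic0 Y)%qT D = \pi_(Pic0 Y)%qT E <-> (D : Div Y) - (E : Div Y) \in lap_image.
Proof.
split=> [/eqP|/lap_imageP DE]; first rewrite -Quotient.idealrBE.
  by move=> /asboolP[F FE]; apply/lap_imageP; exists F; exact: FE.
apply/eqP; rewrite -Quotient.idealrBE; apply/asboolP.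
by have [F FE] := DE; exists F; exact: FE.
Qed.

Lemma pic0_eq0P (D : Div0 Y) : \pi_(Pic0 Y)%qT D = 0 <-> (D : Div Y) \in lap_image.
Proof. by rewrite -[0](raddf0 (\pi_(Pic0 Y)%qT)) pic0_eqP subr0. Qed.

End PrincipalDivisors.

Section GaloisPic.
Variables (Y X : graph) (f : graph_morphism Y X).
Notation G := (Gal f).
Notation ZG := (group_alg int G).

Lemma lap_image_ZG_div (a : ZG) (D : Div Y) :
  D \in @lap_image Y -> ZG_div a D \in @lap_image Y.
Proof.
by move=> /lap_imageP[E <-]; apply/lap_imageP; exists (ZG_div a E); exact: laplacian_ZG_div.
Qed.

Lemma gal_pic0_pi (s : G) (D : Div0 Y) :
  gal_pic0 s (\pi_(Pic0 Y)%qT D) = \pi_(Pic0 Y)%qT (gal_div0 s D).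
Proof.
apply/pic0_eqP; rewrite /= -raddfB /= -ZG_div_group_elt; apply: lap_image_ZG_div.
by apply/pic0_eqP; rewrite reprK.
Qed.

End GaloisPic.

Section PadicAction.
Variables (p : nat) (p_pr : prime p) (Y : graph).
Notation Zp := (padic_int p_pr).

Lemma mulrz_eq_mod (M : zmodType) (x : M) (q : nat) (y z : int) : (1 < q)%N ->
  x *+ q = 0 -> y%:~R = z%:~R :> 'Z_q -> x *~ y = x *~ z.
Proof.
move=> q1 xq /eqP; rewrite intr_Zp_eq // => /dvdzP[k yz].
by rewrite -[y](subrK z) yz mulrzDr mulrC mulrzA -pmulrn xq mul0rz add0r.
Qed.

(** [Zp_pic0] uses the least $k$ with $p^k x = 0$; a larger $N$ gives the same multiple because the
    residues of [z] are compatible. *)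
Lemma Zp_pic0E N (z : Zp) (x : Pic0 Y) (y : int) (N0 : (0 < N)%N) :
  x *+ p ^ N = 0 -> y%:~R = padic_red N0 z -> Zp_pic0 z x = x *~ y.
Proof.
move=> xN yz; rewrite /Zp_pic0; case: pselect => [h|[]]; last first.
  by exists N; rewrite xN.
case: ex_minnP => k /eqP xk kP; have kN : (k <= N)%N by apply: kP; rewrite xN.
have -> : x *~ y = x *+ z N.
  by rewrite pmulrn; apply: mulrz_eq_mod xN _; rewrite ?padic_modulus_gt1.
rewrite -(padic_res_le z kN) [in RHS](divn_eq (z N) (p ^ k)).
by rewrite mulrnDr mulnC mulrnA xk mul0rn add0r.
Qed.

End PadicAction.

(** * The integral lift of the idempotent *)

Section IdempotentLift.
Variables (p : nat) (p_pr : prime p) (gT : finGroupType).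
Notation Zp := (padic_int p_pr).
Variables (psi : gT -> Zp) (psi_char : is_character psi).
Hypothesis card_unit : #|gT|%:R \is a @GRing.unit Zp.
Hypothesis psi_sum0 : \sum_g psi g = 0.
Variables (N : nat) (N_gt0 : (0 < N)%N).
Notation q := (p ^ N)%N.
Notation ZG := (group_alg int gT).
Notation red := (padic_red N_gt0).

(* An integral lift modulo p^N of the idempotent of psi, corrected so that    *)
(* its augmentation is exactly 0.                                             *)
Lemma character_idem_lift : exists e : ZG, [/\ augmentation e = 0,
  forall s, (e s)%:~R = red (character_idem psi s),
  red (char_ext psi_char e) = 1 &
  forall (a : ZG) (z : int), z%:~R = red (char_ext psi_char a) ->
    exists w : ZG, e * a = e *~ z + w *~ q].
Proof.
pose e0 : ZG := [ffun g => (character_idem psi g N)%:Z].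
(* The correction is invisible modulo $q$: the augmentation of [e0] is 0 there, since the values of
   [psi] sum to 0. *)
pose e : ZG := e0 - group_elt 1 *~ augmentation e0.
have augB (a c : ZG) : augmentation (a - c) = augmentation a - augmentation c.
  by rewrite /augmentation -sumrB; apply: eq_bigr => s _; rewrite !ffunE.
have aug1 z : augmentation (group_elt (1%g : gT) *~ z) = z.
  rewrite /augmentation (bigD1 1%g) //= big1 => [|s s1].
    by rewrite group_algMzE ffunE eqxx mul1r addr0.
  by rewrite group_algMzE ffunE (negPf s1) mul0r.
have e0E s : (e0 s)%:~R = red (character_idem psi s) by rewrite ffunE -pmulrn.
have aug_e0 : (augmentation e0)%:~R = 0 :> 'Z_q.
  rewrite rmorph_sum /=; under eq_bigr do rewrite e0E.
  rewrite -(rmorph_sum red); under eq_bigr do rewrite ffunE.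
  by rewrite -mulr_sumr (reindex_inj invg_inj) /=;
     under eq_bigr do rewrite invgK; rewrite psi_sum0 mulr0 rmorph0.
have eE s : (e s)%:~R = red (character_idem psi s).
  rewrite [e s]ffunE [X in _ + X]ffunE group_algMzE intrB intrM aug_e0 mulr0 subr0.
  exact: e0E.
exists e; split=> //.
- by rewrite augB aug1 subrr.
- rewrite /char_ext /character_ext rmorph_sum -[RHS](rmorph1 red) -(mulVr card_unit).
  rewrite mulr_natr -sumr_const (rmorph_sum red); apply: eq_bigr => s _.
  rewrite rmorphMz -mulrzr eE -rmorphM ffunE mulrCA -(characterM psi_char) mulgV.
  by rewrite (character1 psi_char) mulr1.
move=> a z za; have div_q g : (q%:Z %| (e * a) g - e g * z)%Z.
  rewrite -intr_Zp_eq ?padic_modulus_gt1 // intrM za eE ffunE; apply/eqP.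
  (* With $h = gk^{-1}$, the coefficient of $e$ at $h$ is $\psi(k)$ times its coefficient at $g$,
     modulo $q$. *)
  rewrite rmorph_sum (reindex_inj (inj_comp (mulgI g) invg_inj)) /=.
  rewrite /char_ext /character_ext !rmorph_sum mulr_sumr; apply: eq_bigr => k _.
  rewrite invMg invgK mulgKV intrM eE rmorphMz -[X in _ = _ * X]mulrzr mulrA -rmorphM.
  congr (red _ * _); rewrite !ffunE invMg invgK (characterM psi_char).
  by rewrite mulrCA mulrC.
exists [ffun g => (((e * a) g - e g * z) %/ q)%Z]; apply/ffunP => g.
rewrite [RHS]ffunE !group_algMzE [X in _ + X * _]ffunE divzK //.
by rewrite addrC subrK.
Qed.

End IdempotentLift.

(** * The psi-part of Pic^0 *)

Section IdempotentPart.
Variables (p : nat) (p_pr : prime p).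
Variables (Y X : graph) (f : graph_morphism Y X).
Notation G := (Gal f).
Notation ZG := (group_alg int G).
Notation Zp := (padic_int p_pr).
Hypothesis G_abelian : forall s t : G, (s * t = t * s)%g.
Variables (n : nat) (b : 'I_n -> Div Y) (b_basis : ZG_basis f b).
Variables (psi : G -> Zp) (psi_char : is_character psi).
Variables (N : nat) (N_gt0 : (0 < N)%N).
Notation q := (p ^ N)%N.
Notation red := (padic_red N_gt0).
Notation chi := (char_ext psi_char).
Notation L := (ZG_mx f b (@laplacian Y)).

Variable e : ZG.
Hypothesis e_aug : augmentation e = 0.
Hypothesis e_idem : forall s, (e s)%:~R = red (character_idem psi s).
Hypothesis chi_e : red (chi e) = 1.
Hypothesis e_mul : forall (a : ZG) (z : int), z%:~R = red (chi a) ->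
  exists w : ZG, e * a = e *~ z + w *~ q.

(* m is the prime-to-p part of an exponent of Pic^0(Y), whose p-part divides  *)
(* p^N.                                                                       *)
Variable m : int.
Hypothesis m_coprime : coprime `|m| p.
Hypothesis pic0_kill : forall D : Div Y, degree D = 0 ->
  D *~ (m * q) \in @lap_image Y.

Fact idem_div0_subproof (D : Div Y) : ZG_div e D \in degree_zero (Y := Y).
Proof. by rewrite unfold_in degree_ZG_div e_aug mulr0. Qed.

Definition idem_div0 (D : Div Y) : Div0 Y := MkDiv0 (idem_div0_subproof D).

Notation pi := (\pi_(Pic0 Y)%qT).

Lemma degree_idem (D : Div Y) : degree (ZG_div e D) = 0.
Proof. by apply/eqP; exact: idem_div0_subproof. Qed.

(** The difference $ea - ze$ equals $qw$. The divisor $wD$ has degree 0 because $q(wD)$ does, so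
    $mq$ makes it principal. *)
Lemma idem_div_mod (a : ZG) (z : int) (D : Div Y) : z%:~R = red (chi a) ->
  ZG_div (e * a) D *~ m - ZG_div e D *~ (z * m) \in @lap_image Y.
Proof.
move=> /e_mul[w ea]; have wE : ZG_div w D *~ q = ZG_div (e * a) D - ZG_div e D *~ z.
  by rewrite -!ZG_divMzl -ZG_divBl ea addrC addKr.
have q0 : q%:Z != 0 by rewrite -lt0n expn_gt0 prime_gt0.
have w0 : degree (ZG_div w D) = 0.
  apply/(mulIf q0); rewrite mul0r -mulrzz -(raddfMz (@degree Y)) wE.
  rewrite (raddfB (@degree Y)) (raddfMz (@degree Y)) /= ZG_divM //.
  by rewrite !degree_idem mul0rz subrr.
by rewrite mulrzA -mulrzBl -wE -mulrzA mulrC; exact: pic0_kill.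
Qed.

(** Both $mq$ and $p^k$ kill $x$; a Bezout relation $rm + sp^k = 1$, multiplied by $q$, shows that
    $q$ does too. *)
Lemma primary_killed (x : Pic0 Y) : primary_part p x -> x *+ q = 0.
Proof.
move=> [k /eqP xk]; have xmq : x *~ (m * q) = 0.
  rewrite -[x]reprK -(raddfMz pi); apply/pic0_eq0P; rewrite -[div0_val _]/(val _) raddfMz /=.
  by apply: pic0_kill; apply/eqP; exact: div0P.
have /coprimezP[[r s] /= rs] : coprimez m (p ^ k)%N.
  by rewrite coprimezE /= coprimeXr.
have -> : x *+ q = x *~ (m * q * r + (p ^ k)%N%:Z * (s * q%:Z)).
  rewrite pmulrn -[X in x *~ X = _]mul1r -rs; congr (x *~ _).
  by rewrite mulrDl -mulrA [r * _]mulrC [s * _]mulrC mulrA.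
by rewrite mulrzDr mulrzA xmq mul0rz add0r mulrzA -pmulrn xk mul0rz.
Qed.

Lemma ZpG_pic0_idem (D : Div0 Y) : pi D *+ q = 0 ->
  ZpG_pic0 (character_idem psi) (pi D) = pi (idem_div0 D).
Proof.
move=> Dq; have -> : idem_div0 D = \sum_s gal_div0 s D *~ e s.
  apply/val_inj; rewrite raddf_sum [LHS]/= /ZG_div; apply: eq_bigr => s _.
  by rewrite raddfMz.
rewrite (raddf_sum pi); apply: eq_bigr => s _; rewrite (raddfMz pi) /= -gal_pic0_pi.
apply: (Zp_pic0E (N0 := N_gt0)) (e_idem s).
have gal_div0Mn : gal_div0 s (D *+ q) = gal_div0 s D *+ q.
  apply/val_inj; rewrite [RHS]raddfMn /= -(raddfMn (gal_div s)).
  by congr (gal_div s _); rewrite -[LHS]/(val _) raddfMn.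
move: Dq; rewrite gal_pic0_pi -!(raddfMn pi) -gal_div0Mn => /pic0_eq0P Dq.
by apply/pic0_eq0P; rewrite /= -ZG_div_group_elt; exact: lap_image_ZG_div.
Qed.

(* The factor m makes the classes p-primary.                                  *)
Definition lattice_class (u : 'cV[int]_n) : Pic0 Y :=
  pi (idem_div0 (\sum_i b i *~ (u i ord0 * m))).

Notation T := (\matrix_(i, j) (chi (L i j) N)%:Z).

(** From a principal difference, comparing coordinates and applying [chi] modulo $q$ gives $m(u-v)
    \equiv Ty$, and $m$ is invertible modulo $q$. Conversely, columns of $T$ come from the
    Laplacians of the $e b_j$, and $mq$ absorbs $q\mathbb{Z}^n$. *)
Lemma lattice_class_eq (u v : 'cV[int]_n) :
  lattice_class u = lattice_class v <-> col_lattice q T (u - v).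
Proof.
have zgE (x : 'cV[int]_n) : ZG_div e (\sum_i b i *~ (x i ord0 * m)) =
    \sum_i ZG_div (e *~ (x i ord0 * m)) (b i).
  rewrite (raddf_sum (ZG_div e)); apply: eq_bigr => i _.
  by rewrite ZG_divMzl -(raddfMz (ZG_div e)).
rewrite /lattice_class pic0_eqP /= !zgE -sumrB.
under eq_bigr do rewrite -ZG_divBl -mulrzBr -mulrBl.
split=> [/lap_imageP[E]|[y [z uvE]]].
  rewrite -(ZG_coordK b_basis E) laplacian_coord //.
  set d := ZG_coord _ _ E => /(ZG_basis_inj b_basis) dE.
  pose dl : 'cV[int]_n := \col_j (chi (d j) N)%:Z.
  have qdvd i : (q%:Z %| (u - v) i ord0 * m - (T *m dl) i ord0)%Z.
    rewrite -intr_Zp_eq ?padic_modulus_gt1 //; apply/eqP.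
    have /(congr1 chi)/(congr1 red) := dE i.
    rewrite (raddfMz chi) (raddfMz red) /= chi_e => eqz.
    rewrite [(u - v) _ _]mxE [(- v) _ _]mxE -eqz.
    rewrite (raddf_sum chi) (raddf_sum red) mxE rmorph_sum.
    by apply: eq_bigr => j _; rewrite !mxE /= (rmorphM chi) (rmorphM red) intrM [RHS]mulrC.
  pose w i := (((u - v) i ord0 * m - (T *m dl) i ord0) %/ q)%Z.
  have wE i : (u - v) i ord0 * m = (T *m dl) i ord0 + w i * q%:Z.
    by rewrite divzK // addrCA subrr addr0.
  have /coprimezP[[r s] /= rs] : coprimez m q by rewrite coprimezE coprimeXr.
  (* Here $x = rmx + sqx$ for $x = u - v$, and $mx$ is replaced by $T\,dl + qw$. *)
  exists (r *: dl), (\col_i (r * w i + s * (u - v) i ord0)).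
  apply/colP => i; set x := (u - v) _ _.
  have -> : forall W : 'cV[int]_n, (T *m (r *: dl) + q%:Z *: W) i ord0 =
      r * (T *m dl) i ord0 + q%:Z * W i ord0.
    by move=> W; rewrite -scalemxAr mxE; congr (_ + _); rewrite mxE.
  rewrite [X in _ + _ * X]mxE -/x -[LHS]mul1r -rs mulrDl mulrDr addrA.
  congr (_ + _); last by rewrite mulrA [q%:Z * s]mulrC.
  by rewrite [q%:Z * _]mulrCA -mulrDr -mulrA [m * x]mulrC wE [w i * _]mulrC.
pose S j := \sum_i ZG_div e (b i) *~ ((chi (L i j) N)%:Z * m).
have S_im j : S j \in @lap_image Y.
  pose Lm := laplacian (ZG_div e (b j)) *~ m.
  rewrite -[S j](subKr Lm); apply: rpredB.
    by apply/lap_imageMz/lap_imageP; exists (ZG_div e (b j)).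
  rewrite /Lm laplacian_ZG_div -[laplacian (b j)](ZG_coordK b_basis).
  rewrite (raddf_sum (ZG_div e)) mulrz_suml -sumrB.
  apply: rpred_sum => i _; rewrite /= -ZG_divM //.
  by apply: idem_div_mod; rewrite mxE.
have uvi i : u i ord0 - v i ord0 =
    \sum_j (chi (L i j) N)%:Z * y j ord0 + q%:Z * z i ord0.
  have /matrixP/(_ i ord0) := uvE; rewrite [LHS]mxE [RHS]mxE [(- v) _ _]mxE => ->.
  by rewrite [X in X + _]mxE [X in _ + X]mxE; under eq_bigr do rewrite mxE.
have -> : \sum_i ZG_div (e *~ ((u i ord0 - v i ord0) * m)) (b i) =
    \sum_j S j *~ y j ord0 + \sum_i ZG_div e (b i) *~ (m * q%:Z * z i ord0).
  under [X in X + _]eq_bigr do rewrite /S mulrz_suml.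
  rewrite [X in X + _]exchange_big -big_split. apply: eq_bigr => i _ /=.
  rewrite ZG_divMzl uvi mulrDl mulrzDr mulr_suml mulrz_sumr; congr (_ + _).
    by apply: eq_bigr => j _; rewrite -mulrzA mulrAC.
  by rewrite mulrC mulrA.
apply: rpredD; apply: rpred_sum => i _; first exact: lap_imageMz.
by rewrite mulrzA; apply/lap_imageMz/pic0_kill/degree_idem.
Qed.

Lemma idem_div_scale (u : 'cV[int]_n) :
  ZG_div e (\sum_i b i *~ (u i ord0 * m)) = ZG_div e (\sum_i b i *~ u i ord0) *~ m.
Proof.
rewrite -(raddfMz (ZG_div e)) mulrz_suml; congr (ZG_div e _).
by apply: eq_bigr => i _; rewrite mulrzA.
Qed.

(** The class is its own preimage: it is killed by $q$, and $e$ fixes it because [chi e] is 1 modulo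
    $q$. *)
Lemma lattice_class_idem (u : 'cV[int]_n) : idem_part psi (lattice_class u).
Proof.
rewrite /lattice_class; set D := idem_div0 _.
have DE : div0_val D = ZG_div e (\sum_i b i *~ u i ord0) *~ m by exact: idem_div_scale.
have Dq : pi D *+ q = 0.
  rewrite -(raddfMn pi); apply/pic0_eq0P; rewrite -[div0_val _]/(val _) raddfMn.
  rewrite -[X in X *+ _]/(div0_val D) DE pmulrn -mulrzA; exact/pic0_kill/degree_idem.
exists (pi D); first by exists N; rewrite Dq.
rewrite ZpG_pic0_idem //; apply/pic0_eqP.
rewrite [X in X - _](_ : _ = ZG_div e (div0_val D)) // DE (raddfMz (ZG_div e)) /= -ZG_divM //.
by rewrite -[X in _ - _ *~ X]mul1r; apply: idem_div_mod; rewrite chi_e.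
Qed.

Lemma idem_part_lattice (x : Pic0 Y) : idem_part psi x -> exists u, lattice_class u = x.
Proof.
move=> [x0 /primary_killed x0q <-]; move: x0q; rewrite -[x0]reprK.
set D := generic_quotient.repr x0 => Dq; rewrite ZpG_pic0_idem //.
have Dq_im : (D : Div Y) *~ q \in @lap_image Y.
  move: Dq; rewrite -(raddfMn pi) => /pic0_eq0P.
  by rewrite -[div0_val _]/(val _) raddfMn.
have /coprimezP[[r s] /= rs] : coprimez m q by rewrite coprimezE coprimeXr.
pose c := ZG_coord f b D; pose z i := (chi (c i) N)%:Z.
(* Replacing each coordinate $c_i$ of $D$ by $\chi(c_i)$ is harmless after applying $e$; the factor
   $r$, inverse to $m$ modulo $q$, undoes the $m$ built into [lattice_class]. *)
exists (\col_i (z i * r)); apply/esym/pic0_eqP.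
rewrite [div0_val (idem_div0 (\sum_i _))]/= idem_div_scale /=.
have -> : ZG_div e D = ZG_div e D *~ (r * m) + ZG_div e ((D : Div Y) *~ q) *~ s.
  by rewrite (raddfMz (ZG_div e)) -mulrzA -mulrzDr [q%:Z * s]mulrC rs.
rewrite addrAC; apply: rpredD; last exact/lap_imageMz/lap_image_ZG_div.
rewrite -{1}(ZG_coordK b_basis D) !(raddf_sum (ZG_div e)) !mulrz_suml -sumrB.
apply: rpred_sum => i _; rewrite mxE /= -ZG_divM //.
have := lap_imageMz r (idem_div_mod (b i) (erefl : (z i)%:~R = red (chi (c i)))).
by rewrite (raddfMz (ZG_div e)) /= mulrzBl -!mulrzA [m * r]mulrC mulrAC.
Qed.

End IdempotentPart.

(** * Counting the $\psi$-part by lattice cosets *)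

Lemma card_uniq_seq (T : choiceType) (x0 : T) (s : seq T) :
  uniq s -> ([set` s] #= `I_(size s))%card.
Proof.
move=> s_uniq.
have -> : [set` s]%classic = (nth x0 s @` `I_(size s))%classic.
  apply/seteqP; split=> x /=; last by move=> [k ks <-]; exact: mem_nth.
  by move=> xs; exists (index x s); rewrite /= ?index_mem ?nth_index.
apply: inj_card_eq => i j /[!inE] /= ik jk /eqP.
by rewrite nth_uniq // => /eqP.
Qed.

Theorem theorem2 (p : nat) (p_pr : prime p) (p_odd : odd p)
    (Y X : graph) (f : graph_morphism Y X) (f_gal : galois_cover f)
    (Gal_iso : [set: Gal f] \isog [set: {unit 'F_p}])
    (n : nat) (b : 'I_n -> Div Y) (b_basis : ZG_basis f b)
    (psi : Gal f -> padic_int p_pr) (psi_char : is_character psi)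
    (psi_nontrivial : exists s, psi s != 1) :
  exists m : nat, (idem_part psi #= `I_m)%card /\
    m%:R = (padic_abs (h_at_1 b psi))^-1.
Proof.
have Y_conn := cover_source_connected f_gal; have [s0 s0N1] := psi_nontrivial.
have dom : forall x y : padic_int p_pr, x * y = 0 -> (x == 0) || (y == 0).
  exact: padic_mulf_eq0.
have cardG : #|Gal f| = p.-1.
  by rewrite -cardsT (card_isog Gal_iso) card_finField_unit card_Fp.
have G_abelian (s t : Gal f) : (s * t = t * s)%g.
  have: abelian [set: Gal f].
    rewrite (isog_abelian Gal_iso); apply/centsP => u _ v _; apply/val_inj.
    exact: mulrC.
  by move=> /centsP/(_ s (finset.in_setT s) t (finset.in_setT t)).
set L := map_mx (char_ext psi_char) (ZG_mx f b (@laplacian Y)).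
have detL : h_at_1 b psi = \det L by exact: h_at_1E.
have /padic_abs_neq0[v [-> hv hvS]] : h_at_1 b psi != 0.
  rewrite detL; apply: det_laplacian_neq0 s0N1 dom _ => //.
  exact: padic_natr_neq0.
have [c c0 cP] := pic0_exponent Y_conn.
have /(pfactor_coprime p_pr)[m' pm cE] : (0 < `|c|)%N by rewrite absz_gt0.
(* Taking $N > v$ lets reduction modulo $p^N$ detect that $p^{v+1}$ does not divide the determinant;
   taking $N \ge a$ makes $c$ divide $m' p^N$. *)
set a := logn p `|c| in cE; pose N := (a + v).+1.
have N_gt0 : (0 < N)%N by [].
have card_unit : #|Gal f|%:R \is a @GRing.unit (padic_int p_pr).
  by rewrite cardG; exact: padic_predp_unit.
have [e [e_aug e_idem chi_e e_mul]] :=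
  character_idem_lift psi_char card_unit (character_sum0 psi_char s0N1 dom) N_gt0.
pose T : 'M[int]_n :=
  \matrix_(i, j) (char_ext psi_char (ZG_mx f b (@laplacian Y) i j) N)%:Z.
(* $\det T$ and $h(1,\psi)$ agree modulo $p^N$, so divisibility by $p^k$ is the same for both when
   $k \le N$. *)
have detT k : (k <= N)%N -> ((p ^ k)%N %| \det T)%Z = (h_at_1 b psi k == 0%N).
  move=> kN; rewrite -(padic_res_le _ kN).
  have : (\det T)%:~R = padic_red N_gt0 (h_at_1 b psi).
    rewrite detL -!det_map_mx; congr (\det _).
    by apply/matrixP => i j; rewrite !mxE.
  move=> /eqP; rewrite -[X in _ == X]/((h_at_1 b psi N)%:Z%:~R).
  rewrite intr_Zp_eq ?padic_modulus_gt1 // => /dvdzP[t dT].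
  have qk : t * (p ^ N)%N \in dvdz (p ^ k)%N.
    by rewrite dvdz_mull // dvdzE dvdn_exp2l.
  by rewrite -[\det T](subrK (h_at_1 b psi N)%:Z) dT (rpredDl _ qk) dvdzE.
have [I [rep [cardI rep_inj rep_surj]]] : exists (I : finType) (rep : I -> 'cV[int]_n),
    [/\ #|I| = (p ^ v)%N,
    forall i j, col_lattice (p ^ N) T (rep i - rep j) -> i = j &
    forall x, exists i, col_lattice (p ^ N) T (x - rep i)].
  apply: card_lattice_quotient => //; first by rewrite ltnW // ltnS leq_addl.
    by rewrite detT ?hv // ltnW // ltnS leq_addl.
  by rewrite detT // ltnS leq_addl.
have kill (D : Div Y) : degree D = 0 -> D *~ (m'%:Z * (p ^ N)%N) \in @lap_image Y.
  move=> /cP[E LE]; have -> : m'%:Z * (p ^ N)%N = c * (Num.sg c * (p ^ v.+1)%N).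
    by rewrite mulrA [c * _]mulrC -normrEsg -abszE cE /N -addnS expnD !PoszM mulrA.
  by rewrite mulrzA; apply/lap_imageMz/lap_imageP; exists E.
pose cls i := lattice_class b e_aug m' (rep i).
have m'p : coprime `|m'%:Z| p by rewrite coprime_sym.
have clsP := lattice_class_eq G_abelian b_basis e_aug chi_e e_mul m'p kill.
have cls_inj : injective cls by move=> i j /clsP/rep_inj.
exists (p ^ v)%N; split; last by rewrite invrK natrX.
rewrite -cardI cardE -(size_map cls).
have -> : idem_part psi = [set` map cls (enum I)]%classic.
  apply/seteqP; split=> x /=; last first.
    by move=> /mapP[i _ ->]; exact: (lattice_class_idem G_abelian b e_aug e_idem chi_e e_mul kill).
  move=> /(idem_part_lattice G_abelian b_basis e_aug e_idem e_mul m'p kill)[u <-].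
  have [i /clsP->] := rep_surj u.
  by apply: (map_f cls); rewrite mem_enum.
by apply: (card_uniq_seq 0); rewrite map_inj_uniq //; exact: enum_uniq.
Qed.
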